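(* Let $G_{\mathbb R}$ be a connected simple linear non-compact real Lie group with Lie algebra $\mathfrak g_{\mathbb R}$. Then, for every nonzero $x\in\mathfrak g_{\mathbb R}$, we have $\lim_{\nu\to0^+}G_{\mathbb R}\cdot(\nu x)\neq\{0\}$.
   Context: The dot denotes the adjoint action. For $x\in\mathfrak g_{\mathbb R}$, $$\lim_{\nu\to 0^+}G_{\mathbb R}\cdot(\nu x):=\bigcap_{\epsilon>0}\overline{\bigcup_{\nu\in(0,\epsilon)}G_{\mathbb R}\cdot(\nu x)},$$ with closures in the Euclidean topology of $\mathfrak g_{\mathbb R}$. *)

(* Defs.v *)
From HB Require Import structures.
From mathcomp Require Import all_boot all_order all_algebra.
From mathcomp Require Import all_classical all_reals all_analysis.

Set Implicit Arguments.
Unset Strict Implicit.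
Unset Printing Implicit Defensive.

Import Order.TTheory GRing.Theory Num.Theory.
Import numFieldNormedType.Exports.

Local Open Scope classical_set_scope.
Local Open Scope ring_scope.

Section LinearLieGroups.
Context {R : realType} {n : nat}.
Implicit Types (G I g : set 'M[R]_n) (X Y x : 'M[R]_n).

(* A linear Lie group is taken to be a closed subgroup of GL_n(R), where
   GL_n(R) carries the subspace topology of 'M[R]_n (G need not be closed in
   'M[R]_n).  By Cartan's theorem it is then an embedded Lie subgroup. *)
Definition linear_lie_group G : Prop :=
  [/\ G `<=` [set A | A \in unitmx],
      G 1%:M,
      forall A B, G A -> G B -> G (A *m B),
      forall A, G A -> G (invmx A) &
      closure G `&` [set A | A \in unitmx] `<=` G].

(* The entries converge absolutely for every X, so lim is a genuine limit. *)
Definition expmx X : 'M[R]_n :=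
  lim (series (fun k => (k`!%:R)^-1 *: X ^+ k) @ \oo).

Definition lie_algebra G : set 'M[R]_n :=
  [set X | forall t : R, G (expmx (t *: X))].

Definition bracket X Y : 'M[R]_n := X *m Y - Y *m X.

Definition lie_ideal g I : Prop :=
  [/\ I `<=` g,
      I 0,
      forall (a : R) X Y, I X -> I Y -> I (a *: X + Y) &
      forall X Y, g X -> I Y -> I (bracket X Y)].

Definition simple_lie_algebra g : Prop :=
  (exists X Y, [/\ g X, g Y & bracket X Y <> 0]) /\
  (forall I, lie_ideal g I -> I = [set 0] \/ I = g).

Definition Ad (A X : 'M[R]_n) : 'M[R]_n := A *m X *m invmx A.

Definition Ad_orbit G X : set 'M[R]_n := [set Ad A X | A in G].

(* The closure of a subset of g in the subspace topology of g is the trace on g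
   of its closure in 'M[R]_n. *)
Definition orbit_limit G x : set 'M[R]_n :=
  \bigcap_(e in [set e : R | 0 < e])
    (lie_algebra G `&`
     closure (\bigcup_(nu in [set nu : R | 0 < nu < e]) Ad_orbit G (nu *: x))).

End LinearLieGroups.

(* Main.v *)
Require Import Defs.
From mathcomp Require Import all_boot all_order all_algebra.
From mathcomp Require Import all_classical all_reals all_analysis.

From mathcomp Require Import ring lra.

Import Order.TTheory GRing.Theory Num.Theory.
Import numFieldNormedType.Exports.

Local Open Scope classical_set_scope.
Local Open Scope ring_scope.

Set Implicit Arguments.
Unset Strict Implicit.

(** Suppose first that the orbit of [x] is unbounded.  Choosing [nu] as the inverse
    of the norm of [Ad g x] for larger and larger [Ad g x], the points
    [Ad g (nu x)] have norm 1 and accumulate, by compactness of the sphere, at a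
    nonzero point of the limit ([unbounded_orbit_limit]).

    Suppose that the orbit of [x] is bounded.  We show that [G] is compact.  The
    vectors with bounded orbits form a nonzero ideal, so all orbits in the Lie
    algebra are bounded.  Since [g (exp X) g^-1 = exp (Ad g X)], exponentials have
    bounded conjugacy classes.  In a connected [G] a closed subgroup whose Lie
    algebra is everything is [G] itself ([lie_subgroup_full]); thus all elements
    of [G] have bounded conjugacy classes.  The same principle, applied to closed
    subgroups containing all commutators, shows that [G] is topologically perfect
    ([simple_group_perfect]), so that it has no nontrivial continuous character.

    It remains to see that a topologically perfect group with bounded conjugacy
    classes is bounded in every representation ([bounded_representation]).  An
    unbounded one has an invariant subspace, namely the kernel of a limit of
    [rho g / |rho g|], so by induction it is an extension of two bounded
    representations.  Its off-diagonal block is governed by a cocycle, which is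
    bounded up to invariant vectors; on the latter it is additive and thus
    vanishes ([cocycle_bounded]).  Separating invariant vectors by invariant
    linear forms is done by minimizing a uniformly convex invariant gauge
    ([hyperplane_fixed_point]), so that no Haar measure, Killing form or
    complete reducibility theorem is involved.

    On the Lie side everything rests on one lemma, [lie_algebra_tangent]: a limit
    of difference quotients of a closed subgroup at the identity belongs to its
    Lie algebra. *)

(** * Limits of matrices *)

Section MatrixTopology.
Context {R : realType}.

Lemma closure_filter (T : topologicalType) (E : set T) (x : T) :
  closure E x -> exists F : set_system T, [/\ ProperFilter F, F E & F --> x].
Proof.
rewrite closureEcvg => -[F FF [Fx EF]]; exists F; split => //.
by apply: EF.
Qed.

Lemma cvg_closure (T : topologicalType) (S : Type) (F : set_system S)
    {FF : ProperFilter F} (f : S -> T) (E : set T) (x : T) :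
  f @ F --> x -> (\forall t \near F, E (f t)) -> closure E x.
Proof.
move=> fx FE B /fx FB.
by have [t [? ?]] := filter_ex (@filterI _ F _ _ _ FE FB); exists (f t).
Qed.

Lemma near_eq_cvg_to (S : Type) (T : topologicalType) (F : set_system S)
    {FF : Filter F} (f g : S -> T) (x : T) :
  (\forall t \near F, f t = g t) -> f @ F --> x -> g @ F --> x.
Proof.
move=> fg fx B /fx FB.
by apply: filterS2 fg FB => t /= <-.
Qed.

Lemma cvg_sum (T : Type) (F : set_system T) {FF : Filter F} (I : Type)
    (r : seq I) (f : I -> T -> R) (a : I -> R) :
  (forall i, f i @ F --> a i) ->
  (fun t => \sum_(i <- r) f i t) @ F --> \sum_(i <- r) a i.
Proof.
move=> fa; elim: r => [|i r IH].
  by rewrite big_nil; under eq_fun do rewrite big_nil; exact: cvg_cst.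
by rewrite big_cons; under eq_fun do rewrite big_cons; exact: cvgD.
Qed.

Lemma cvg_prod (T : Type) (F : set_system T) {FF : Filter F} (I : Type)
    (r : seq I) (f : I -> T -> R) (a : I -> R) :
  (forall i, f i @ F --> a i) ->
  (fun t => \prod_(i <- r) f i t) @ F --> \prod_(i <- r) a i.
Proof.
move=> fa; elim: r => [|i r IH].
  by rewrite big_nil; under eq_fun do rewrite big_nil; exact: cvg_cst.
by rewrite big_cons; under eq_fun do rewrite big_cons; exact: cvgM.
Qed.

Lemma normr_entry_le m n (A : 'M[R]_(m, n)) i j : `|A i j| <= `|A|.
Proof.
rewrite [leRHS]/Num.norm /= mx_normrE.
by apply/bigmax_geP; right; exists (i, j).
Qed.

Lemma normr_mx_le m n (A : 'M[R]_(m, n)) c :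
  0 <= c -> (forall i j, `|A i j| <= c) -> `|A| <= c.
Proof.
move=> c0 Ac; rewrite /Num.norm /= mx_normrE.
by apply: bigmax_le => // -[i j] _; exact: Ac.
Qed.

(** The norm of a matrix is its largest entry in absolute value, which is
    submultiplicative only up to the inner dimension: hence the factors [n%:R]
    in all later estimates. *)
Lemma normr_mulmx m n p (A : 'M[R]_(m, n)) (B : 'M[R]_(n, p)) :
  `|A *m B| <= n%:R * `|A| * `|B|.
Proof.
apply: normr_mx_le => [|i j]; first by rewrite !mulr_ge0.
rewrite mxE (le_trans (ler_norm_sum _ _ _))//.
apply: (@le_trans _ _ (\sum_(k < n) `|A| * `|B|)).
  by apply: ler_sum => k _; rewrite normrM ler_pM// normr_entry_le.
by rewrite sumr_const card_ord -[leLHS]mulr_natl mulrA.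
Qed.

Lemma normr_mx1_le n : `|1%:M : 'M[R]_n| <= 1.
Proof.
apply: normr_mx_le => // i j; rewrite mxE.
by case: eqP => _; rewrite ?mulr1n ?mulr0n ?normr1 ?normr0.
Qed.

Lemma cvg_mxP (T : Type) (F : set_system T) {FF : Filter F} m n
    (f : T -> 'M[R]_(m, n)) (A : 'M[R]_(m, n)) :
  (forall i j, (fun t => f t i j) @ F --> A i j) <-> f @ F --> A.
Proof.
split=> fA.
  apply/cvgrPdist_le => e e0.
  have H : \forall t \near F, forall ij : 'I_m * 'I_n,
      `|A ij.1 ij.2 - f t ij.1 ij.2| <= e.
    apply: filter_forall => -[i j].
    by have /cvgrPdist_le := fA i j; apply.
  apply: filterS H => t H.
  by apply: normr_mx_le => [|i j]; [exact: ltW | rewrite !mxE; exact: (H (i, j))].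
move=> i j; apply/cvgrPdist_le => e e0.
move/cvgrPdist_le : fA => /(_ e e0); apply: filterS => t /(le_trans _); apply.
by have := normr_entry_le (A - f t) i j; rewrite !mxE.
Qed.

Lemma cvg_mulmx (T : Type) (F : set_system T) {FF : Filter F} m n p
    (f : T -> 'M[R]_(m, n)) (g : T -> 'M[R]_(n, p))
    (A : 'M[R]_(m, n)) (B : 'M[R]_(n, p)) :
  f @ F --> A -> g @ F --> B -> (fun t => f t *m g t) @ F --> A *m B.
Proof.
move=> /cvg_mxP fA /cvg_mxP gB; apply/cvg_mxP => i j.
rewrite mxE; under eq_fun do rewrite mxE.
by apply: cvg_sum => k; exact: cvgM.
Qed.

Lemma cvg_mxtrace (T : Type) (F : set_system T) {FF : Filter F} n
    (f : T -> 'M[R]_n) (A : 'M[R]_n) :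
  f @ F --> A -> (fun t => \tr (f t)) @ F --> \tr A.
Proof. by move=> /cvg_mxP fA; exact: cvg_sum. Qed.

Lemma cvg_det (T : Type) (F : set_system T) {FF : Filter F} n
    (f : T -> 'M[R]_n) (A : 'M[R]_n) :
  f @ F --> A -> (fun t => \det (f t)) @ F --> \det A.
Proof.
move=> /cvg_mxP fA; apply: cvg_sum => s.
apply: cvgM; first exact: cvg_cst.
exact: cvg_prod.
Qed.

Lemma cvg_invmx (T : Type) (F : set_system T) {FF : Filter F} n
    (f : T -> 'M[R]_n) (A : 'M[R]_n) :
  A \in unitmx -> (\forall t \near F, f t \in unitmx) ->
  f @ F --> A -> (fun t => invmx (f t)) @ F --> invmx A.
Proof.
move=> uA uf fA.
apply: (@near_eq_cvg_to _ _ _ _ (fun t => (\det (f t))^-1 *: \adj (f t))).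
  by apply: filterS uf => t uft; rewrite /invmx uft.
rewrite /invmx uA; apply: cvgZ.
  apply: cvgV; last exact: cvg_det.
  by move: uA; rewrite unitmxE unitfE.
apply/cvg_mxP => i j; rewrite mxE; under eq_fun do rewrite mxE.
apply: cvgM; first exact: cvg_cst.
apply: cvg_det; apply/cvg_mxP => k l; rewrite !mxE.
under eq_fun do rewrite !mxE.
by move/cvg_mxP : fA; apply.
Qed.

Lemma ultra_fmap (S T : Type) (U : set_system S) (f : S -> T) :
  UltraFilter U -> UltraFilter (f @ U).
Proof.
move=> UU; split; first exact: fmap_proper_filter.
move=> G GG UG; apply/seteqP; split=> A GA; last exact: UG.
have [//|UnA] := in_ultra_setVsetC (f @^-1` A) UU.
have [t [At]] := filter_ex (@filterI _ G _ _ _ GA (UG (~` A) UnA)).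
by move=> /(_ At).
Qed.

(** Bolzano-Weierstrass, entry by entry. *)
Lemma ultra_bounded_cvg (T : Type) (U : set_system T) (UU : UltraFilter U) m n
    (f : T -> 'M[R]_(m, n)) c :
  (\forall t \near U, `|f t| <= c) -> exists A : 'M[R]_(m, n), f @ U --> A.
Proof.
move=> fc.
have H i j : exists a : R, (fun t => f t i j) @ U --> a.
  have Uij : UltraFilter ((fun t => f t i j) @ U) by exact: ultra_fmap.
  have := @segment_compact R (- c) c; rewrite compact_ultra.
  move=> /(_ _ Uij)[|a [_ ?]]; last by exists a.
  apply: filterS fc => t tc /=.
  by rewrite in_itv /= -ler_norml (le_trans _ tc)// normr_entry_le.
exists (\matrix_(i, j) projT1 (cid (H i j))); apply/cvg_mxP => i j.
by rewrite mxE; exact: projT2 (cid (H i j)).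
Qed.

Lemma bounded_closed_compact_mx m n (A : set 'M[R]_(m, n)) c :
  (forall M, A M -> `|M| <= c) -> closed A -> compact A.
Proof.
move=> Ac cA; rewrite compact_ultra => U UU UA.
have [|M UM] := @ultra_bounded_cvg _ U UU _ _ id c.
  by apply: filterS UA.
exists M; split; last exact: UM.
exact: (@closed_cvg _ _ U _ id A).
Qed.

(** An ultrafilter plays the role of a sequence on which [f] tends to infinity
    and from which no further subsequence needs to be extracted. *)
Lemma unbounded_ultra (T : Type) m n (G : set T) (f : T -> 'M[R]_(m, n)) :
  ~ (exists c, forall g, G g -> `|f g| <= c) ->
  exists U : set_system T,
    [/\ UltraFilter U, U G & forall c, \forall g \near U, c < `|f g|].
Proof.
move=> nb; pose B c := [set g | G g /\ c < `|f g|].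
have H c : exists g, B c g.
  apply/not_existsP => nB; apply: nb; exists c => g Gg.
  by rewrite leNgt; apply/negP => cg; exact: (nB g).
pose F := filter_from [set: R] B.
have FF : ProperFilter F.
  apply: filter_from_proper => [|c _]; last exact: H.
  apply: filter_from_filter; first by exists 0.
  move=> a b _ _; exists (Num.max a b) => // g [Gg].
  by rewrite gt_max => /andP[? ?].
have [U [UU FU]] := ultraFilterLemma FF.
exists U; split => //; first by apply: FU; exists 0 => // g [].
by move=> c; apply: FU; exists c => // g [].
Qed.

(** This is how every unboundedness hypothesis below is used: normalized values
    of [f] converge to a nonzero limit, while anything bounded becomes
    negligible after the same normalization. *)
Lemma unbounded_direction (T : Type) m n (G : set T) (f : T -> 'M[R]_(m, n)) :
  ~ (exists c, forall g, G g -> `|f g| <= c) ->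
  exists (U : set_system T) (A : 'M[R]_(m, n)),
    [/\ UltraFilter U, U G, (fun g => `|f g|^-1) @ U --> (0 : R),
        (fun g => `|f g|^-1 *: f g) @ U --> A & `|A| = 1].
Proof.
move=> /unbounded_ultra[U [UU UG fU]].
have N1 : \forall g \near U, `| `|f g|^-1 *: f g| = 1.
  apply: filterS (fU 0) => g g0.
  by rewrite normrZ normfV normr_id mulVf// gt_eqF.
have [|A fA] := @ultra_bounded_cvg _ U UU _ _ (fun g => `|f g|^-1 *: f g) 1.
  by apply: filterS N1 => g ->.
exists U, A; split=> //.
  apply/cvgrPdist_lt => e e0; apply: filterS (fU e^-1) => g ge.
  have g0 : 0 < `|f g| by rewrite (lt_trans _ ge)// invr_gt0.
  by rewrite sub0r normrN ger0_norm ?invr_ge0// invf_plt ?posrE.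
have /cvg_norm := fA => nA.
have : (fun g => `| `|f g|^-1 *: f g|) @ U --> (1 : R).
  by apply: cvg_near_cst; apply: filterS N1.
by move=> /(cvg_unique _ nA)->.
Qed.

(** A subspace is the kernel of a matrix, here of the cokernel matrix of a matrix
    [D] of maximal rank whose row space lies in the subspace. *)
Lemma subspace_closed m n (P : set 'M[R]_(m, n)) :
  P 0 -> (forall a A B, P A -> P B -> P (a *: A + B)) -> closed P.
Proof.
move=> P0 PD.
pose Q d (D : 'M[R]_(d, m * n)) := forall v, (v <= D)%MS -> P (vec_mx v).
pose r k := `[< exists D : 'M[R]_(m * n), Q _ D /\ \rank D = k >].
have exr : exists k, r k.
  exists 0%N; apply/asboolP; exists 0; split; last by rewrite mxrank0.
  by move=> v; rewrite submx0 => /eqP->; rewrite linear0.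
have ubr k : r k -> (k <= m * n)%N.
  by move=> /asboolP[D [_ <-]]; exact: rank_leq_row.
have [k /asboolP[D [QD Dk]] kmax] := ex_maxnP exr ubr.
have PE M : P M <-> mxvec M *m cokermx D = 0.
  split=> [PM|/eqP]; last first.
    by rewrite -submxE => /QD; rewrite mxvecK.
  have Q' : Q _ (D + mxvec M)%MS.
    move=> v /sub_addsmxP[[u w] /= ->].
    rewrite linearD /= addrC (mx11_scalar w) mul_scalar_mx linearZ /= mxvecK.
    by apply: PD => //; apply: QD; exact: submxMl.
  have /kmax : r (\rank (D + mxvec M)%MS) by apply/asboolP; exists (D + mxvec M)%MS.
  rewrite -Dk => le; apply/eqP; rewrite -submxE.
  apply: (submx_trans (addsmxSr D _)).
  by have := mxrank_leqif_sup (addsmxSl D (mxvec M)) => -[_ <-];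
    rewrite eqn_leq le mxrankS// addsmxSl.
move=> M /closure_filter[F [FF FP FM]]; apply/PE.
have mM : mxvec @ F --> mxvec M.
  apply/cvg_mxP => i l; rewrite ord1; case/mxvec_indexP: l => a b.
  rewrite mxvecE; under eq_fun do rewrite mxvecE.
  by move/cvg_mxP : FM; apply.
have lim0 : (fun N => mxvec N *m cokermx D) @ F --> (0 : 'M[R]_(1, m * n)).
  by apply: cvg_near_cst; apply: filterS FP => N /PE.
exact: cvg_unique (cvg_mulmx mM (cvg_cst _)) lim0.
Qed.

End MatrixTopology.

(** * The matrix exponential *)

(** The product of two partial sums is the partial sum of the Cauchy product,
    plus the corner above the antidiagonal. *)
Lemma sum_triangle (S : pzRingType) (a b : nat -> S) N :
  (\sum_(i < N) a i) * (\sum_(j < N) b j) =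
  \sum_(k < N) \sum_(i < k.+1) a i * b (k - i)%N +
  \sum_(i < N) \sum_(j < N | (N <= i + j)%N) a i * b j.
Proof.
have -> : \sum_(k < N) \sum_(i < k.+1) a i * b (k - i)%N =
    \sum_(i < N) \sum_(j < N | ~~ (N <= i + j)%N) a i * b j.
  under eq_bigr => k _ do
    rewrite (big_ord_widen _ (fun i => a i * b (k - i)%N) (ltn_ord k)) big_mkcond.
  rewrite exchange_big; apply: eq_bigr => i _ /=.
  rewrite -(big_mkord xpredT (fun k => if (i < k.+1)%N then a i * b (k - i)%N else 0)).
  rewrite -big_mkcond/= (@big_cat_nat _ _ _ i 0 N)//=; last exact: ltnW.
  rewrite big_nat_cond big_pred0 ?add0r; last first.
    by move=> k; rewrite ltnS /=; case: ltnP => //=; rewrite andbF.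
  rewrite -{1}(add0n i) big_addn big_mkord.
  rewrite (big_ord_widen_cond _ (fun j => i < (j + i).+1)%N (fun j => a i * b (j + i - i)%N) (leq_subr i N)).
  apply: eq_big => [j|j _]; last by rewrite addnK.
  by rewrite ltnS leq_addl /= -ltnNge ltn_subRL.
rewrite big_distrlr /= -big_split /=; apply: eq_bigr => i _.
by rewrite (bigID (fun j : 'I_N => (N <= i + j)%N)) /= addrC.
Qed.

Lemma fact_binE (R : realType) k i : (i <= k)%N ->
  (k`!%:R)^-1 * 'C(k, i)%:R = (i`!%:R)^-1 * ((k - i)`!%:R)^-1 :> R.
Proof.
move=> ik; have f0 j : j`!%:R != 0 :> R by rewrite pnatr_eq0 -lt0n fact_gt0.
rewrite -[in LHS](bin_fact ik) !natrM.
have : 'C(k, i)%:R != 0 :> R by rewrite pnatr_eq0 -lt0n bin_gt0.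
by move=> b0; field; rewrite !f0 b0.
Qed.

Section MatrixExponential.
Context {R : realType} {n : nat}.
Implicit Types X Y A : 'M[R]_n.

Definition expmx_coeff X k : 'M[R]_n := (k`!%:R)^-1 *: X ^+ k.

Lemma normr_expX X k : `|X ^+ k| <= (n%:R * `|X|) ^+ k.
Proof.
elim: k => [|k IH]; first by rewrite !expr0 normr_mx1_le.
rewrite !exprS (le_trans (normr_mulmx _ _))//.
by rewrite ler_wpM2l// mulr_ge0.
Qed.

Lemma normr_expmx_coeff X k :
  `|expmx_coeff X k| <= exp_coeff (n%:R * `|X|) k.
Proof.
rewrite normrZ gtr0_norm ?invr_gt0 ?ltr0n ?fact_gt0// /exp_coeff /=.
by rewrite [leRHS]mulrC ler_wpM2l ?invr_ge0// normr_expX.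
Qed.

Lemma cvg_expmx X : series (expmx_coeff X) @ \oo --> expmx X.
Proof.
have cv i j : cvgn (series (fun k => expmx_coeff X k i j)).
  apply: normed_cvg.
  apply: (@series_le_cvg _ _ (exp_coeff (n%:R * `|X|))) => [k|k|k|] //=.
  - by rewrite exp_coeff_ge0// mulr_ge0.
  - exact: le_trans (normr_entry_le _ _ _) (normr_expmx_coeff _ _).
  - exact: is_cvg_series_exp_coeff.
suff : series (expmx_coeff X) @ \oo -->
    (\matrix_(i, j) limn (series (fun k => expmx_coeff X k i j))).
  by move=> h; move/cvgP : (h).
apply/cvg_mxP => i j; rewrite mxE.
apply: near_eq_cvg_to (cv i j); near=> N.
by rewrite /series /= summxE.
Unshelve. all: by end_near. Qed.

Lemma cvg_expR (x : R) : series (exp_coeff x) @ \oo --> expR x.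
Proof. exact: is_cvg_series_exp_coeff. Qed.

(** Every estimate on [expmx] comes from this comparison with the scalar
    exponential, used with [m = 0], [1] and [2]. *)
Lemma normr_expmx_tail X m :
  `|expmx X - series (expmx_coeff X) m| <=
  expR (n%:R * `|X|) - series (exp_coeff (n%:R * `|X|)) m.
Proof.
set x := n%:R * `|X|.
apply: (@ler_cvg_to _ \oo _ _ (fun N => `|series (expmx_coeff X) N -
    series (expmx_coeff X) m|) (fun N => series (exp_coeff x) N -
    series (exp_coeff x) m)).
- by apply: cvg_norm; apply: cvgB; [exact: cvg_expmx|exact: cvg_cst].
- by apply: cvgB; [exact: cvg_expR|exact: cvg_cst].
- near=> N; rewrite !sub_series_geq; try by near: N; exact: nbhs_infty_ge.
  apply: le_trans (ler_norm_sum _ _ _) _.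
  by apply: ler_sum => k _; exact: normr_expmx_coeff.
Unshelve. all: by end_near. Qed.

Lemma normr_expmx_le X : `|expmx X| <= expR (n%:R * `|X|).
Proof.
by have := normr_expmx_tail X 0; rewrite /series /= !big_geq// !subr0.
Qed.

Lemma normr_expmx_sub1_sub X : n%:R * `|X| <= 2^-1 ->
  `|expmx X - 1%:M - X| <= 2 * (n%:R * `|X|) ^+ 2.
Proof.
set x := n%:R * `|X| => xle.
have x0 : 0 <= x by rewrite mulr_ge0.
have := normr_expmx_tail X 2.
rewrite /series /= !big_nat_recr//= !big_geq// !add0r /expmx_coeff /exp_coeff /=.
rewrite fact0 factS fact0 muln1 invr1 !scale1r !expr0 !expr1 !mulr1 !opprD.
rewrite !addrA => /le_trans; apply.
have x1 : 0 < 1 - x by rewrite subr_gt0 (le_lt_trans xle)// invf_lt1// ltr1n.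
have ex : expR x <= (1 - x)^-1.
  rewrite -[x in leLHS]opprK expRN lef_pV2 ?posrE ?expR_gt0//.
  by rewrite (le_trans _ (expR_ge1Dx _)).
have : (1 - x)^-1 - 1 - x = x ^+ 2 / (1 - x).
  by field; rewrite gt_eqF.
move=> h; apply: (@le_trans _ _ (x ^+ 2 / (1 - x))).
  by rewrite -h !lerD2r.
rewrite mulrC ler_wpM2r ?sqr_ge0// invf_ple ?posrE//; lra.
Qed.

Lemma expmx_coeffD X Y k : X *m Y = Y *m X ->
  expmx_coeff (X + Y) k =
  \sum_(i < k.+1) expmx_coeff X i * expmx_coeff Y (k - i).
Proof.
move=> XY; rewrite /expmx_coeff addrC exprDn_comm; last exact/esym.
rewrite scaler_sumr; apply: eq_bigr => i _.
have ik : (i <= k)%N by rewrite -ltnS.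
rewrite -mulmxE -scalemxAl -scalemxAr scalerA -fact_binE// -scalerA.
rewrite scaler_nat; congr (_ *: (_ *+ _)).
by apply: commrX; apply/commr_sym/commrX; exact: XY.
Qed.

Lemma exp_coeffD (x y : R) k :
  exp_coeff (x + y) k = \sum_(i < k.+1) exp_coeff x i * exp_coeff y (k - i)%N.
Proof.
rewrite /exp_coeff /= addrC exprDn mulr_suml; apply: eq_bigr => i _.
have ik : (i <= k)%N by rewrite -ltnS.
have -> : x ^+ i / i`!%:R * (y ^+ (k - i) / (k - i)`!%:R) =
  (y ^+ (k - i) * x ^+ i) * ((i`!%:R)^-1 * ((k - i)`!%:R)^-1) by ring.
by rewrite -fact_binE// -[X in X / _]mulr_natr; ring.
Qed.

(** By [sum_triangle] the product of the partial sums for [X] and [Y] differs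
    from that for [X + Y] by the corner terms, and these are dominated by the
    corner terms of the scalar series, for which the addition theorem holds. *)
Lemma expmxD X Y : X *m Y = Y *m X -> expmx (X + Y) = expmx X *m expmx Y.
Proof.
move=> XY; set x := n%:R * `|X|; set y := n%:R * `|Y|.
have x0 : 0 <= x by rewrite mulr_ge0.
have y0 : 0 <= y by rewrite mulr_ge0.
pose D N := series (expmx_coeff X) N *m series (expmx_coeff Y) N -
  series (expmx_coeff (X + Y)) N.
pose d N := series (exp_coeff x) N * series (exp_coeff y) N -
  series (exp_coeff (x + y)) N.
have cD : D @ \oo --> expmx X *m expmx Y - expmx (X + Y).
  by apply: cvgB; [apply: cvg_mulmx|]; exact: cvg_expmx.
have cd : (fun N => n%:R * d N) @ \oo --> n%:R * (expR x * expR y - expR (x + y)).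
  apply: cvgM; first exact: cvg_cst.
  by apply: cvgB; [apply: cvgM|]; exact: cvg_expR.
have Dd N : `|D N| <= n%:R * d N.
  rewrite /D /d /series /= !big_mkord mulmxE !sum_triangle.
  under [X in _ + _ - X]eq_bigr do rewrite expmx_coeffD//.
  under [X in n%:R * (_ + _ - X)]eq_bigr do rewrite exp_coeffD.
  rewrite ![_ + _ - _]addrAC !subrr !add0r mulr_sumr.
  apply: le_trans (ler_norm_sum _ _ _) _; apply: ler_sum => i _.
  rewrite mulr_sumr; apply: le_trans (ler_norm_sum _ _ _) _; apply: ler_sum => j _.
  apply: le_trans (normr_mulmx _ _) _.
  by rewrite -mulrA ler_wpM2l// ler_pM// normr_expmx_coeff.
have : `|expmx X *m expmx Y - expmx (X + Y)| <= n%:R * (expR x * expR y - expR (x + y)).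
  apply: (ler_cvg_to (cvg_norm cD) cd); near=> N; exact: Dd.
by rewrite expRD subrr mulr0 normr_le0 subr_eq0 => /eqP.
Unshelve. all: by end_near. Qed.

Lemma expmx0 : expmx (0 : 'M[R]_n) = 1%:M.
Proof.
have := @normr_expmx_sub1_sub 0; rewrite normr0 mulr0 expr0n mulr0 subr0.
by rewrite normr_le0 subr_eq0 invr_ge0 => /(_ (ler0n _ _))/eqP.
Qed.

Lemma expmxZD X (s t : R) :
  expmx ((s + t) *: X) = expmx (s *: X) *m expmx (t *: X).
Proof.
by rewrite scalerDl expmxD// -!scalemxAl -!scalemxAr !scalerA mulrC.
Qed.

Lemma expmxN_mul X : expmx (- X) *m expmx X = 1%:M.
Proof. by rewrite -expmxD ?addNr ?expmx0// mulNmx mulmxN. Qed.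

Lemma expmx_unit X : expmx X \in unitmx.
Proof. by have /mulmx1_unit[] := expmxN_mul X. Qed.

Lemma invmx_expmx X : invmx (expmx X) = expmx (- X).
Proof.
by rewrite -[RHS](mulmxK (expmx_unit X)) expmxN_mul mul1mx.
Qed.

Lemma expmx_natZ X k : expmx (k%:R *: X) = expmx X ^+ k.
Proof.
elim: k => [|k IH]; first by rewrite scale0r expmx0.
by rewrite exprS -natr1 addrC expmxZD scale1r IH.
Qed.

Lemma expmx_conj A X : A \in unitmx ->
  A *m expmx X *m invmx A = expmx (A *m X *m invmx A).
Proof.
move=> uA.
have conjX k : A *m (X ^+ k) *m invmx A = (A *m X *m invmx A) ^+ k.
  elim: k => [|k IH]; first by rewrite !expr0 mulmx1 mulmxV.
  by rewrite !exprS -IH -!mulmxE !mulmxA mulmxKV.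
have cA : (fun N => A *m series (expmx_coeff X) N *m invmx A) @ \oo -->
    A *m expmx X *m invmx A.
  apply: cvg_mulmx; last exact: cvg_cst.
  by apply: cvg_mulmx; [exact: cvg_cst|exact: cvg_expmx].
suff cB : (fun N => A *m series (expmx_coeff X) N *m invmx A) @ \oo -->
    expmx (A *m X *m invmx A) by exact: cvg_unique cA cB.
apply: near_eq_cvg_to (@cvg_expmx (A *m X *m invmx A)); near=> N.
rewrite /series /= mulmx_sumr mulmx_suml; apply: eq_bigr => k _.
by rewrite /expmx_coeff -scalemxAr -scalemxAl conjX.
Unshelve. all: by end_near. Qed.

Lemma normr_expmx_quot X (s : R) : s != 0 -> n%:R * `|s *: X| <= 2^-1 ->
  `|s^-1 *: (expmx (s *: X) - 1%:M) - X| <= 2 * (n%:R * `|X|) ^+ 2 * `|s|.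
Proof.
move=> s0 /normr_expmx_sub1_sub; rewrite normrZ => h.
have -> : s^-1 *: (expmx (s *: X) - 1%:M) - X =
    s^-1 *: (expmx (s *: X) - 1%:M - s *: X).
  by rewrite [in RHS]scalerBr scalerA mulVf// scale1r.
rewrite normrZ normfV ler_pdivrMl ?normr_gt0//.
by apply: le_trans h _; rewrite le_eqVlt; apply/orP; left; apply/eqP; ring.
Qed.

Lemma cvg_scale0 (T : Type) (F : set_system T) {FF : Filter F} X (s : T -> R) :
  s @ F --> 0 -> (fun t => n%:R * `|s t *: X|) @ F --> (0 : R).
Proof.
move=> s0; rewrite -(mulr0 n%:R).
apply: cvgM; first exact: cvg_cst.
rewrite -(@normr0 _ 'M[R]_n) -(scale0r X).
by apply: cvg_norm; exact: cvgZr_tmp.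
Qed.

Lemma cvg_expmx_quot (T : Type) (F : set_system T) {FF : Filter F} X
    (s : T -> R) :
  s @ F --> 0 -> (\forall t \near F, s t != 0) ->
  (fun t => (s t)^-1 *: (expmx (s t *: X) - 1%:M)) @ F --> X.
Proof.
move=> s0 sn0.
have c1 := @cvg_scale0 _ F FF X s s0.
have c2 : (fun t => 2 * (n%:R * `|X|) ^+ 2 * `|s t|) @ F --> (0 : R).
  have : (fun t => `|s t|) @ F --> (0 : R).
    by rewrite -(@normr0 _ R); exact: cvg_norm.
  by move=> /(cvgM (cvg_cst (2 * (n%:R * `|X|) ^+ 2))); rewrite mulr0.
apply/cvgrPdist_lt => e e0.
near=> t; rewrite distrC.
apply: le_lt_trans (normr_expmx_quot _ _) _.
- by near: t.
- near: t.
  have : (0 : R) < 2^-1 by rewrite invr_gt0.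
  by move: c1 => /cvgr_le; apply.
- near: t; move: c2 => /cvgr_lt; exact.
Unshelve. all: by end_near. Qed.

Lemma cvg_expmx_scale (T : Type) (F : set_system T) {FF : Filter F} X
    (s : T -> R) (a : R) :
  s @ F --> a -> (fun t => expmx (s t *: X)) @ F --> expmx (a *: X).
Proof.
move=> sa.
suff H : (fun t => expmx ((s t - a) *: X)) @ F --> (1%:M : 'M[R]_n).
  rewrite -[X in _ --> X]mulmx1.
  under eq_fun => t do rewrite -(subrK a (s t)) addrC expmxZD.
  by apply: cvg_mulmx => //; exact: cvg_cst.
have s0 : (fun t => s t - a) @ F --> 0.
  by rewrite -(subrr a); apply: cvgB => //; exact: cvg_cst.
have e0 : (fun t => expR (n%:R * `|(s t - a) *: X|) - 1) @ F --> (0 : R).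
  have : (fun t => expR (n%:R * `|(s t - a) *: X|)) @ F --> expR (0 : R).
    exact: (cvg_comp _ _ (@cvg_scale0 _ F FF X _ s0) (@continuous_expR R 0)).
  move=> h; have := cvgB h (cvg_cst (1 : R)); rewrite expR0 subrr; exact.
apply/cvgrPdist_lt => e /(cvgr_lt _ e0); apply: filterS => t; apply: le_lt_trans.
have := normr_expmx_tail ((s t - a) *: X) 1.
by rewrite distrC /series /= !big_nat1 /expmx_coeff /exp_coeff /= fact0 invr1
  scale1r !expr0 mulr1.
Qed.

(** As the norm is not submultiplicative, powers of a matrix near [1] have to be
    bounded through [A - 1]; submultiplicativity up to [n] would lose a factor
    [n ^ k]. *)
Lemma normr_mull1 (A B : 'M[R]_n) :
  `|A * B| <= (1 + n%:R * `|A - 1%:M|) * `|B|.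
Proof.
have -> : A * B = B + (A - 1%:M) *m B by rewrite mulmxBl mul1mx addrC subrK.
apply: le_trans (ler_normD _ _) _; rewrite mulrDl mul1r lerD2l.
exact: normr_mulmx.
Qed.

Lemma normr_exprM1 (A : 'M[R]_n) k :
  `|A ^+ k| <= (1 + n%:R * `|A - 1%:M|) ^+ k.
Proof.
elim: k => [|k IH]; first by rewrite !expr0 normr_mx1_le.
rewrite exprS; apply: le_trans (normr_mull1 _ _) _.
by rewrite exprS ler_wpM2l// addr_ge0// mulr_ge0.
Qed.

Lemma normr_exprB (A B : 'M[R]_n) c k :
  1 + n%:R * `|A - 1%:M| <= c -> 1 + n%:R * `|B - 1%:M| <= c ->
  `|A ^+ k - B ^+ k| <= k%:R * (n%:R * `|A - B|) * c ^+ k.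
Proof.
move=> Ac Bc; have c1 : 1 <= c by rewrite (le_trans _ Ac)// lerDl mulr_ge0.
have c0 : 0 <= c by rewrite (le_trans _ c1).
elim: k => [|k IH]; first by rewrite !expr0 subrr normr0 !mul0r.
have -> : A ^+ k.+1 - B ^+ k.+1 = A * (A ^+ k - B ^+ k) + (A - B) * B ^+ k.
  by rewrite !exprS mulrBr mulrBl addrA subrK.
apply: le_trans (ler_normD _ _) _.
have H1 : `|A * (A ^+ k - B ^+ k)| <= c * `|A ^+ k - B ^+ k|.
  by apply: le_trans (normr_mull1 _ _) _; rewrite ler_wpM2r.
have H2 : `|(A - B) * B ^+ k| <= n%:R * `|A - B| * c ^+ k.+1.
  apply: le_trans (normr_mulmx _ _) _; rewrite ler_wpM2l// ?mulr_ge0//.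
  apply: le_trans (normr_exprM1 _ _) _.
  apply: (@le_trans _ _ (c ^+ k)); last by rewrite ler_weXn2l.
  by rewrite lerXn2r ?nnegrE// addr_ge0// mulr_ge0.
apply: le_trans (lerD H1 H2) _.
apply: le_trans (_ : c * (k%:R * (n%:R * `|A - B|) * c ^+ k) + n%:R * `|A - B| * c ^+ k.+1 <= _).
  by rewrite lerD2r ler_wpM2l.
by rewrite exprS -natr1 le_eqVlt; apply/orP; left; apply/eqP; ring.
Qed.

End MatrixExponential.

(** * Tangent vectors to a closed subgroup *)

Section TangentVectors.
Context {R : realType} {n : nat}.
Implicit Types (G H : set 'M[R]_n) (X Y A B : 'M[R]_n).

Lemma lie_group_unit G A : linear_lie_group G -> G A -> A \in unitmx.
Proof. by case=> + _ _ _ _; apply. Qed.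

Lemma lie_groupX G A k : linear_lie_group G -> G A -> G (A ^+ k).
Proof.
case=> _ G1 GM _ _ GA; elim: k => [|k IH]; first by rewrite expr0.
by rewrite exprS; exact: GM.
Qed.

Lemma lie_group_closed G (T : Type) (F : set_system T) {FF : ProperFilter F}
    (h : T -> 'M[R]_n) A : linear_lie_group G ->
  (\forall t \near F, G (h t)) -> h @ F --> A -> A \in unitmx -> G A.
Proof.
case=> _ _ _ _ cG Gh hA uA; apply: cG; split=> //.
exact: cvg_closure hA Gh.
Qed.

Lemma lie_algebraZ G X (a : R) : lie_algebra G X -> lie_algebra G (a *: X).
Proof. by move=> GX t; rewrite scalerA. Qed.

(** With [k] the integer part of [a / s], the powers [h ^ k] converge to
    [exp (a X)], because [h - exp (s X) = o(s)] and the error is multiplied by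
    [k = O(1 / s)] only; closedness of [G] then applies.  All members of a Lie
    algebra constructed below are found as such limits. *)
Lemma lie_algebra_tangent G (T : Type) (F : set_system T) {FF : ProperFilter F}
    (h : T -> 'M[R]_n) (s : T -> R) X : linear_lie_group G ->
  (\forall t \near F, G (h t)) -> (\forall t \near F, 0 < s t) ->
  s @ F --> 0 -> (fun t => (s t)^-1 *: (h t - 1%:M)) @ F --> X ->
  lie_algebra G X.
Proof.
move=> linG Gh s_gt0 s0 hX.
suff pos (a : R) : 0 < a -> G (expmx (a *: X)).
  move=> t; have [t0|t0|->] := ltgtP t 0; last 2 first.
  - exact: pos.
  - by rewrite scale0r expmx0; case: linG.
  rewrite -[t]opprK scaleNr -invmx_expmx.
  by case: linG => _ _ _ GV _; apply: GV; apply: pos; rewrite oppr_gt0.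
move=> a0; pose k t := Num.truncn (a / s t).
have k_le : \forall t \near F, a - s t <= (k t)%:R * s t <= a.
  apply: filterS s_gt0 => t st.
  have /Num.Theory.truncn_itv : 0 <= a / s t by rewrite divr_ge0// ltW.
  rewrite -/(k t) ler_pdivlMr// ltr_pdivrMr// -natr1 mulrDl mul1r.
  by move=> /andP[-> /ltW]; rewrite andbT lerBlDr.
pose e t := expmx (s t *: X).
have eX : (fun t => (s t)^-1 *: (e t - 1%:M)) @ F --> X.
  by apply: cvg_expmx_quot => //; apply: filterS s_gt0 => t; rewrite lt0r => /andP[].
have ek : (fun t => e t ^+ k t) @ F --> expmx (a *: X).
  under eq_fun => t do rewrite -expmx_natZ scalerA.
  apply: cvg_expmx_scale; apply: (@squeeze_cvgr _ _ _ _ (fun t => a - s t) (fun=> a)).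
  - exact: k_le.
  - by rewrite -[X in _ --> X]subr0; apply: cvgB => //; exact: cvg_cst.
  - exact: cvg_cst.
pose C := n%:R * (`|X| + 1).
have C0 : 0 <= C by rewrite mulr_ge0// addr_ge0.
have small (f : T -> 'M[R]_n) : (fun t => (s t)^-1 *: (f t - 1%:M)) @ F --> X ->
    \forall t \near F, 1 + n%:R * `|f t - 1%:M| <= 1 + s t * C.
  move=> fX; have X1 : `|X| < `|X| + 1 by rewrite ltrDl.
  have : \forall t \near F, `|(s t)^-1 *: (f t - 1%:M)| < `|X| + 1.
    exact: (cvgr_lt _ (cvg_norm fX)).
  apply: filterS2 s_gt0 => t st.
  rewrite normrZ normfV (gtr0_norm st) ltr_pdivrMl// => /ltW le.
  by rewrite lerD2l mulrCA ler_wpM2l.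
have bound : \forall t \near F, `|h t ^+ k t - e t ^+ k t| <=
   a * n%:R * expR (a * C) * `|(s t)^-1 *: (h t - 1%:M) - (s t)^-1 *: (e t - 1%:M)|.
  near=> t.
  have st : 0 < s t by near: t.
  have ksa : (k t)%:R * s t <= a by near: t; apply: filterS k_le => ? /andP[].
  have hC : 1 + n%:R * `|h t - 1%:M| <= 1 + s t * C by near: t; exact: small.
  have eC : 1 + n%:R * `|e t - 1%:M| <= 1 + s t * C by near: t; exact: small.
  apply: le_trans (normr_exprB _ hC eC) _.
  have -> : `|h t - e t| =
      s t * `|(s t)^-1 *: (h t - 1%:M) - (s t)^-1 *: (e t - 1%:M)|.
    rewrite -scalerBr opprB addrA subrK normrZ normfV (gtr0_norm st).
    by rewrite mulrA mulfV ?mul1r// gt_eqF.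
  set d := `|_ - _|; have d0 : 0 <= d by exact: normr_ge0.
  have pw : (1 + s t * C) ^+ k t <= expR (a * C).
    apply: (@le_trans _ _ (expR (s t * C) ^+ k t)).
      rewrite lerXn2r ?nnegrE ?expR_ge0 ?expR_ge1Dx//.
      by rewrite addr_ge0// mulr_ge0// ltW.
    by rewrite -expRM_natl ler_expR mulrA ler_wpM2r.
  have -> : (k t)%:R * (n%:R * (s t * d)) * (1 + s t * C) ^+ k t =
     ((k t)%:R * s t) * (n%:R * d * (1 + s t * C) ^+ k t) by ring.
  have -> : a * n%:R * expR (a * C) * d = a * (n%:R * d * expR (a * C)) by ring.
  apply: ler_pM => //.
  - by rewrite mulr_ge0// ltW.
  - by apply: mulr_ge0; [exact: mulr_ge0|rewrite exprn_ge0// addr_ge0// mulr_ge0// ltW].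
  - by rewrite ler_wpM2l// mulr_ge0.
have lim0 : (fun t => h t ^+ k t - e t ^+ k t) @ F --> (0 : 'M[R]_n).
  apply/norm_cvg0P; apply: (@squeeze_cvgr _ _ _ _ (fun=> 0) (fun t =>
    a * n%:R * expR (a * C) * `|(s t)^-1 *: (h t - 1%:M) - (s t)^-1 *: (e t - 1%:M)|)).
  - by apply: filterS bound => t ?; rewrite normr_ge0.
  - exact: cvg_cst.
  have lim0 := cvg_norm (cvgB hX eX).
  rewrite -(mulr0 (a * n%:R * expR (a * C))) -(@normr0 _ 'M[R]_n) -(subrr X).
  by apply: cvgM; [exact: cvg_cst|exact: lim0].
apply: (@lie_group_closed G T F _ (fun t => h t ^+ k t)) => //.
- by apply: filterS Gh => t Gt; exact: (lie_groupX _ linG Gt).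
- have hk : (fun t => h t ^+ k t - e t ^+ k t + e t ^+ k t) @ F -->
      0 + expmx (a *: X) by exact: cvgD.
  rewrite add0r in hk; apply: near_eq_cvg_to hk.
  by apply: nearW => t /=; rewrite subrK.
- exact: expmx_unit.
Unshelve. all: by end_near. Qed.

End TangentVectors.

(** * Lie algebras and closed subgroups *)

Lemma commutator_quot (K : fieldType) n (s : K) (a b : 'M[K]_n) :
  a \in unitmx -> b \in unitmx ->
  (s^-1 *: (a - 1%:M) *m (s^-1 *: (b - 1%:M)) -
   s^-1 *: (b - 1%:M) *m (s^-1 *: (a - 1%:M))) *m (invmx a *m invmx b) =
  (s * s)^-1 *: (a *m b *m invmx a *m invmx b - 1%:M).
Proof.
move=> ua ub; have E p q : (p - 1%:M) *m (q - 1%:M) = p *m q - (p + q - 1%:M) :> 'M[K]_n.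
  by rewrite mulmxBl !mulmxBr !mul1mx mulmx1 -addrA -opprD addrA.
rewrite -!(scalemxAl, scalemxAr) !scalerA -scalerBr -scalemxAl invfM.
congr (_ *: _).
rewrite !E (addrC b a); move: (a + b - 1%:M) => c; rewrite opprB addrA subrK.
by rewrite mulmxBl !mulmxA -(mulmxA b) mulmxV// mulmx1 mulmxV.
Qed.

Lemma conj_quot (K : fieldType) n (s : K) (a Y : 'M[K]_n) : a \in unitmx ->
  (s^-1 *: (a - 1%:M) *m Y - Y *m (s^-1 *: (a - 1%:M))) *m invmx a =
  s^-1 *: (-1 *: Y + a *m Y *m invmx a).
Proof.
move=> ua; rewrite -!(scalemxAl, scalemxAr) -scalerBr -scalemxAl; congr (_ *: _).
rewrite (mulmxBl a) mulmxBr mul1mx mulmx1 opprB addrA subrK mulmxBl mulmxK//.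
by rewrite scaleN1r addrC.
Qed.

Section LieAlgebra.
Context {R : realType} {n : nat}.
Implicit Types (G H I : set 'M[R]_n) (X Y A B : 'M[R]_n).

Let cvg_id0 : (fun s : R => s) @ 0^'+ --> (0 : R).
Proof. exact: cvg_at_right_filter. Qed.

Let near_gt0 : \forall s \near (0 : R)^'+, 0 < s.
Proof. exact: nbhs_right_gt. Qed.

Let cvg_quot X : (fun s : R => s^-1 *: (expmx (s *: X) - 1%:M)) @ 0^'+ --> X.
Proof.
apply: cvg_expmx_quot; first exact: cvg_id0.
by apply: filterS near_gt0 => s /lt0r_neq0.
Qed.

Let cvg_expmx1 X : (fun s : R => expmx (s *: X)) @ 0^'+ --> (1%:M : 'M[R]_n).
Proof. by rewrite -expmx0 -(scale0r X); exact: cvg_expmx_scale. Qed.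

Lemma lie_algebra0 G : linear_lie_group G -> lie_algebra G 0.
Proof. by case=> _ ? _ _ _ t; rewrite scaler0 expmx0. Qed.

Lemma lie_algebraD G X Y : linear_lie_group G ->
  lie_algebra G X -> lie_algebra G Y -> lie_algebra G (X + Y).
Proof.
move=> linG GX GY; have [_ _ GM _ _] := linG.
apply: (@lie_algebra_tangent _ _ G R (0 : R)^'+ _
  (fun s => expmx (s *: X) *m expmx (s *: Y)) id) => //.
  by apply: nearW => s; apply: GM.
have cXY : (fun s : R => s^-1 *: (expmx (s *: X) - 1%:M) *m expmx (s *: Y) +
    s^-1 *: (expmx (s *: Y) - 1%:M)) @ 0^'+ --> X *m 1%:M + Y.
  by apply: cvgD => //; exact: cvg_mulmx.
rewrite mulmx1 in cXY; apply: near_eq_cvg_to cXY; apply: nearW => s.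
by rewrite -scalemxAl -scalerDr mulmxBl mul1mx addrA subrK.
Qed.

Lemma lie_algebra_lin G (a : R) X Y : linear_lie_group G ->
  lie_algebra G X -> lie_algebra G Y -> lie_algebra G (a *: X + Y).
Proof. by move=> linG GX GY; apply: lie_algebraD => //; exact: lie_algebraZ. Qed.

Lemma lie_algebra_closed G : linear_lie_group G -> closed (lie_algebra G).
Proof.
move=> linG; apply: subspace_closed; first exact: lie_algebra0.
by move=> a X Y; exact: lie_algebra_lin.
Qed.

Lemma lie_algebra_Ad G H A X : linear_lie_group G -> G A ->
  (forall B, H B -> H (A *m B *m invmx A)) ->
  lie_algebra H X -> lie_algebra H (Ad A X).
Proof.
move=> linG GA HA HX t.
rewrite /Ad scalemxAl scalemxAr -expmx_conj; first exact: HA.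
exact: lie_group_unit GA.
Qed.

(** The commutator of [exp (s X)] and [exp (s Y)] is [1 + s^2 [X, Y] + o(s^2)],
    so the tangent parameter is [s^2]. *)
Lemma lie_algebra_commutator G H X Y : linear_lie_group H ->
  (forall A B, G A -> G B -> H (A *m B *m invmx A *m invmx B)) ->
  lie_algebra G X -> lie_algebra G Y -> lie_algebra H (bracket X Y).
Proof.
move=> linH HC GX GY.
pose c s := expmx (s *: X) *m expmx (s *: Y) *m invmx (expmx (s *: X))
  *m invmx (expmx (s *: Y)).
apply: (@lie_algebra_tangent _ _ H R (0 : R)^'+ _ c (fun s => s * s)) => //.
- by apply: nearW => s; apply: HC; [exact: GX|exact: GY].
- by apply: filterS near_gt0 => s s0; exact: mulr_gt0.
- have s2 : (fun s : R => s * s) @ 0^'+ --> (0 * 0 : R) by exact: cvgM.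
  by rewrite mulr0 in s2.
pose u s := s^-1 *: (expmx (s *: X) - 1%:M).
pose v s := s^-1 *: (expmx (s *: Y) - 1%:M).
have cXY : (fun s : R => (u s *m v s - v s *m u s) *m
    (expmx (s *: - X) *m expmx (s *: - Y))) @ 0^'+ -->
    (X *m Y - Y *m X) *m (1%:M *m 1%:M).
  by apply: cvg_mulmx; [apply: cvgB|]; apply: cvg_mulmx => //; exact: cvg_quot.
rewrite !mulmx1 in cXY; apply: near_eq_cvg_to cXY; apply: nearW => s.
rewrite /u /v /c !scalerN -!invmx_expmx.
by apply: commutator_quot; exact: expmx_unit.
Qed.

(** The bracket [[X, Y]] is the derivative at [s = 0] of [Ad (exp (s X)) Y], a
    curve in [I], and the subspace [I] is closed. *)
Lemma Ad_invariant_ideal G I : linear_lie_group G -> I `<=` lie_algebra G ->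
  I 0 -> (forall a X Y, I X -> I Y -> I (a *: X + Y)) ->
  (forall A X, G A -> I X -> I (Ad A X)) -> lie_ideal (lie_algebra G) I.
Proof.
move=> linG Ig I0 ID IAd; split=> // X Y GX IY.
have cI : closed I by exact: subspace_closed.
have cXY : (fun s : R => (s^-1 *: (expmx (s *: X) - 1%:M) *m Y -
    Y *m (s^-1 *: (expmx (s *: X) - 1%:M))) *m expmx (s *: - X)) @ 0^'+ -->
    (X *m Y - Y *m X) *m 1%:M.
  by apply: cvg_mulmx => //; apply: cvgB; apply: cvg_mulmx => //; exact: cvg_cst.
rewrite mulmx1 in cXY.
apply: cI; apply: (cvg_closure cXY); apply: nearW => s.
have -> : (s^-1 *: (expmx (s *: X) - 1%:M) *m Y -
    Y *m (s^-1 *: (expmx (s *: X) - 1%:M))) *m expmx (s *: - X) =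
    s^-1 *: (-1 *: Y + Ad (expmx (s *: X)) Y) + 0.
  by rewrite addr0 scalerN -invmx_expmx conj_quot// expmx_unit.
apply: (ID _ _ 0) => //; apply: ID => //; apply: IAd => //; exact: GX.
Qed.

(** This replaces the exponential chart.  Let [A] in [G] be near [1] and outside
    [H], and let [B] be an almost nearest point of [H].  The limit direction [Y]
    of [A - B] is tangent to [G], so that [B exp (|A - B| Y)] belongs to [H] and
    is much closer to [A] than [B] is. *)
Lemma lie_subgroup_open G H : linear_lie_group G -> linear_lie_group H ->
  H `<=` G -> lie_algebra G `<=` lie_algebra H ->
  \forall A \near (1%:M : 'M[R]_n), G A -> H A.
Proof.
move=> linG linH HG gh; apply: contrapT => nH.
have near_pt A : G A -> ~ H A ->
    exists B, [/\ H B, 0 < `|A - B| & forall C, H C -> `|A - B| <= 2 * `|A - C|].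
  move=> GA HA; pose D := [set `|A - B| | B in H].
  have D0 : D !=set0 by exists `|A - 1%:M|; exists 1%:M => //; case: linH.
  have lbD : lbound D 0 by move=> _ [B _ <-].
  have hD : has_inf D by split => //; exists 0.
  (* a point of [G] outside [H] is not in the closure of [H] *)
  have infD0 : 0 < inf D.
    rewrite lt_neqAle lb_le_inf// andbT; apply/eqP => inf0; apply: HA.
    case: (linH) => _ _ _ _; apply; split; last exact: lie_group_unit GA.
    move=> U /nbhs_ballP[e /= e0 eU].
    have [_ [B HB <-] Be] := inf_adherent e0 hD.
    by exists B; split => //; apply: eU; rewrite -ball_normE /= -[e]add0r inf0.
  have [_ [B HB <-] Be] := inf_adherent infD0 hD.
  exists B; split => //.
    by apply: lt_le_trans infD0 _; apply: ge_inf; [exists 0|exists B].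
  move=> C HC; have : inf D <= `|A - C| by apply: ge_inf; [exists 0|exists C].
  by move: Be; lra.
pose D := [set A | G A /\ ~ H A].
have clD : closure D 1%:M.
  move=> U nU; apply: contrapT => DU; apply: nH; apply: filterS nU => A UA GA.
  by apply: contrapT => HA; apply: DU; exists A.
have [F [FF FD F1]] := closure_filter clD.
have [U [UU FU]] := ultraFilterLemma FF.
have UD : U D by exact: FU.
have {FU F1}U1 : id @ U --> (1%:M : 'M[R]_n) by move=> V /F1 /FU.
have /choice[b bP] A : exists B, D A ->
    [/\ H B, 0 < `|A - B| & forall C, H C -> `|A - B| <= 2 * `|A - C|].
  have [[GA HA]|nD] := pselect (D A); last by exists 1%:M.
  by have [B BP] := near_pt _ GA HA; exists B.
have H1 : H 1%:M by case: linH.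
pose s A := `|A - b A|.
have s_gt0 : \forall A \near U, 0 < s A by apply: filterS UD => A /bP[].
have A1 : (fun A => `|A - 1%:M|) @ U --> (0 : R).
  have : (fun A : 'M[R]_n => `|A - 1%:M|) @ U --> `|1%:M - 1%:M : 'M[R]_n|.
    by apply: cvg_norm; apply: cvgB => //; exact: cvg_cst.
  by rewrite subrr normr0.
have s0 : s @ U --> (0 : R).
  apply: (@squeeze_cvgr _ _ _ _ (fun=> 0) (fun A => 2 * `|A - 1%:M|)).
  - by apply: filterS UD => A /bP[_ ? /(_ _ H1) ?]; rewrite normr_ge0.
  - exact: cvg_cst.
  - have : (fun A : 'M[R]_n => 2 * `|A - 1%:M|) @ U --> (2 * 0 : R).
      by apply: cvgM => //; exact: cvg_cst.
    by rewrite mulr0.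
have b1 : b @ U --> (1%:M : 'M[R]_n).
  have Ab : (fun A => A - b A) @ U --> (0 : 'M[R]_n) by apply/norm_cvg0P.
  have : (fun A => A - (A - b A)) @ U --> (1%:M - 0 : 'M[R]_n).
    by apply: cvgB; [exact: U1|exact: Ab].
  by rewrite subr0; apply: near_eq_cvg_to; apply: nearW => A; rewrite subKr.
pose dir A := (s A)^-1 *: (A - b A).
have [Y dirY] : exists Y : 'M[R]_n, dir @ U --> Y.
  apply: (@ultra_bounded_cvg _ _ _ UU _ _ _ 1).
  apply: filterS s_gt0 => A sA.
  by rewrite normrZ normfV (gtr0_norm sA) mulVf// gt_eqF.
have Hb : \forall A \near U, H (b A) by apply: filterS UD => A /bP[].
have GY : lie_algebra G Y.
  apply: (@lie_algebra_tangent _ _ _ _ U _ (fun A => invmx (b A) *m A) s) => //.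
    have [_ _ GM GV _] := linG.
    by apply: filterS2 UD Hb => A [GA _] HbA; apply: GM => //; apply/GV/HG.
  have : (fun A => invmx (b A) *m dir A) @ U --> invmx 1%:M *m Y.
    apply: cvg_mulmx => //; apply: cvg_invmx => //; first exact: unitmx1.
    by apply: filterS Hb => A HbA; exact: lie_group_unit linH HbA.
  rewrite invmx1 mul1mx; apply: near_eq_cvg_to; apply: filterS Hb => A HbA.
  by rewrite -scalemxAr mulmxBr mulVmx//; exact: lie_group_unit HbA.
have /(cvg_norm) : (fun A => dir A - b A *m ((s A)^-1 *: (expmx (s A *: Y) - 1%:M))) @ U -->
    Y - 1%:M *m Y.
  apply: cvgB; first exact: dirY.
  apply: cvg_mulmx; first exact: b1.
  by apply: cvg_expmx_quot => //; apply: filterS s_gt0 => A /lt0r_neq0.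
rewrite mul1mx subrr normr0 => lim0.
have : (2^-1 : R) <= 0.
  apply: (ler_cvg_to (cvg_cst (2^-1 : R)) lim0).
  apply: filterS2 UD s_gt0 => A /bP[HbA _ bmin] sA.
  have : H (b A *m expmx (s A *: Y)).
    by case: linH => _ _ HM _ _; apply: HM => //; exact: gh.
  move=> /bmin; rewrite -/(s A) => h.
  rewrite /dir -scalemxAr -scalerBr mulmxBr mulmx1 opprB addrA subrK.
  rewrite normrZ normfV (gtr0_norm sA) ler_pdivlMl//; lra.
by rewrite leNgt invr_gt0 ltr0n.
Qed.

(** Translating the previous lemma, [H] is relatively open in the connected set
    [G], and it is relatively closed.  A property of the elements of [G] is
    proved below by checking it on exponentials and showing that it cuts out a
    closed subgroup. *)
Lemma lie_subgroup_full G H : linear_lie_group G -> connected G ->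
  linear_lie_group H -> H `<=` G -> lie_algebra G `<=` lie_algebra H -> H = G.
Proof.
move=> linG connG linH HG gh; have [_ H1 HM HV HC] := linH.
have [_ G1 GM GV _] := linG.
pose P : set 'M[R]_n := fun A => G A -> H A.
have nP : nbhs (1%:M : 'M[R]_n) P := lie_subgroup_open linG linH HG gh.
apply: connG; first by exists 1%:M.
- exists (\bigcup_(B in H) ((fun A => invmx B *m A) @^-1` P^°)).
    apply: bigcup_open => B HB; apply: open_comp; last exact: open_interior.
    by move=> A _; apply: (@cvg_mulmx _ _ (nbhs A) _); [apply: cvg_cst|apply: cvg_id].
  apply/seteqP; split=> [A HA|A [GA [B HB BA]]].
    split; first exact: HG.
    by exists A => //=; rewrite mulVmx// (lie_group_unit linH).
  rewrite -(mulKVmx (lie_group_unit linH HB) A); apply: (HM) => //.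
  apply: (interior_subset BA); apply: GM => //; exact/GV/HG.
- exists (closure H); first exact: closed_closure.
  apply/seteqP; split=> [A HA|A [GA HA]].
    by split; [exact: HG|exact: subset_closure].
  by apply: HC; split => //; exact: lie_group_unit GA.
Qed.

End LieAlgebra.

(** * A fixed point theorem *)

Section InvariantFunctional.
Context {R : realType} {a b : nat}.
Implicit Types x y : 'M[R]_(a, b).

(** Unlike the norm of the matrix space, this one satisfies the parallelogram
    law. *)
Definition sqr_norm x : R := \sum_i \sum_j x i j ^+ 2.

Lemma sqr_normZ (k : R) x : sqr_norm (k *: x) = k ^+ 2 * sqr_norm x.
Proof.
rewrite /sqr_norm mulr_sumr; apply: eq_bigr => i _.
by rewrite mulr_sumr; apply: eq_bigr => j _; rewrite mxE exprMn.
Qed.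

Lemma sqr_norm_parallelogram x y :
  sqr_norm (x + y) + sqr_norm (x - y) = 2 * sqr_norm x + 2 * sqr_norm y.
Proof.
rewrite /sqr_norm !mulr_sumr -!big_split; apply: eq_bigr => i _ /=.
rewrite !mulr_sumr -!big_split; apply: eq_bigr => j _ /=.
by rewrite !mxE; ring.
Qed.

Lemma normr_sqr_le x : `|x| ^+ 2 <= sqr_norm x.
Proof.
have S0 i : 0 <= \sum_j x i j ^+ 2 by apply: sumr_ge0 => j _; exact: sqr_ge0.
have S : 0 <= sqr_norm x by exact: sumr_ge0.
rewrite -[leRHS]sqr_sqrtr// lerXn2r ?nnegrE ?sqrtr_ge0//.
apply: normr_mx_le => [|i j]; first exact: sqrtr_ge0.
rewrite -sqrtr_sqr ler_sqrt// /sqr_norm (bigD1 i)//= (bigD1 j)//= -addrA lerDl.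
by apply: addr_ge0; apply: sumr_ge0 => // k _; exact: sqr_ge0.
Qed.

Lemma sqr_norm_le x : sqr_norm x <= a%:R * b%:R * `|x| ^+ 2.
Proof.
apply: (@le_trans _ _ (\sum_(i < a) \sum_(j < b) `|x| ^+ 2)).
  apply: ler_sum => i _; apply: ler_sum => j _.
  by rewrite -[leLHS]ger0_norm ?sqr_ge0// normrX lerXn2r ?nnegrE// normr_entry_le.
by rewrite !sumr_const !card_ord -[X in X *+ a]mulr_natl -[X in X <= _]mulr_natl mulrA.
Qed.

(** This plays the role of averaging over a compact group.  The gauge [phi x], the
    supremum over [g] of [sqr_norm (g x)], does not increase under the action and
    is uniformly convex by the parallelogram law.  If [x] almost minimizes it on
    the hyperplane, then so does [g x], hence the two are close. *)
Lemma hyperplane_fixed_point (T : Type) (G : set T)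
    (act : T -> {linear 'M[R]_(a, b) -> 'M[R]_(a, b)}) (e : T) (C : R)
    (m : 'M[R]_(b, a)) :
  G e -> (forall x, act e x = x) ->
  (forall g h, G g -> G h -> exists2 k, G k & forall x, act g (act h x) = act k x) ->
  (forall g, G g -> exists2 k, G k & forall x, act k (act g x) = x) ->
  (forall g x, G g -> `|act g x| <= C * `|x|) ->
  (forall g x, G g -> \tr (act g x *m m) = \tr (x *m m)) -> m != 0 ->
  exists2 x, \tr (x *m m) = 1 & forall g, G g -> act g x = x.
Proof.
move=> Ge acte actM actV actC acttr m0.
pose K := [set x | \tr (x *m m) = 1].
have [x0 Kx0] : exists x, K x.
  have mT : \tr (m^T *m m) = sqr_norm m^T.
    apply: eq_bigr => i _; rewrite mxE; apply: eq_bigr => j _.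
    by rewrite !mxE expr2.
  have m1 : sqr_norm m^T != 0.
    apply: contra m0 => /eqP S0; have := normr_sqr_le m^T; rewrite S0.
    by rewrite le_eqVlt ltNge sqr_ge0 orbF sqrf_eq0 normr_eq0 trmx_eq0.
  exists ((sqr_norm m^T)^-1 *: m^T).
  by rewrite /K /= -scalemxAl linearZ /= mT mulVf.
(* the neutral element fixes [x0 != 0] *)
have C1 : 1 <= C.
  have x0_gt0 : 0 < `|x0|.
    rewrite normr_gt0; apply/eqP => x00.
    by move: Kx0; rewrite x00 /K /= mul0mx mxtrace0 => /esym/eqP; rewrite oner_eq0.
  by have := actC e x0 Ge; rewrite acte -[X in X <= _]mul1r ler_pM2r.
have C_gt0 : 0 < C by rewrite (lt_le_trans _ C1).
have C0 := ltW C_gt0.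
pose A x := [set sqr_norm (act g x) | g in G].
have hasA x : has_sup (A x).
  split; first by exists (sqr_norm (act e x)), e.
  exists (a%:R * b%:R * (C * `|x|) ^+ 2) => _ [g Gg <-].
  apply: le_trans (sqr_norm_le _) _; rewrite ler_wpM2l ?mulr_ge0//.
  by rewrite lerXn2r ?nnegrE ?mulr_ge0// actC.
pose phi x := sup (A x).
have phi_ub x g : G g -> sqr_norm (act g x) <= phi x.
  by move=> Gg; apply: ub_le_sup; [case: (hasA x)|exists g].
have phi_ge0 x : 0 <= phi x.
  by apply: le_trans (phi_ub x e Ge); apply: le_trans (normr_sqr_le _); exact: sqr_ge0.
pose D := [set phi x | x in K].
have hasD : has_inf D.
  by split; [exists (phi x0), x0|exists 0 => _ [x _ <-]].
have infD x : K x -> inf D <= phi x.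
  by move=> Kx; apply: ge_inf; [case: hasD|exists x].
have almost_fixed eps x g : K x -> phi x < inf D + eps -> G g ->
    `|act g x - x| ^+ 2 <= 4 * C ^+ 2 * eps.
  move=> Kx xeps Gg; set y := act g x.
  have Ky : K y by rewrite /K /= acttr.
  have phiy : phi y <= phi x.
    apply: ge_sup; first by case: (hasA y).
    move=> _ [h Gh <-]; have [k Gk hk] := actM _ _ Gh Gg.
    by rewrite /y hk phi_ub.
  (* the midpoint gains a quarter of the squared distance *)
  pose z := 2^-1 *: (x + y).
  have Kz : K z.
    rewrite /K /z /= -scalemxAl linearZ /= mulmxDl linearD /= Kx Ky.
    by rewrite -mulr2n mulVf// pnatr_eq0.
  have : phi z <= phi x - `|y - x| ^+ 2 / (4 * C ^+ 2).
    apply: ge_sup; first by case: (hasA z).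
    move=> _ [h Gh <-].
    have -> : sqr_norm (act h z) = 2^-1 * sqr_norm (act h x) +
        2^-1 * sqr_norm (act h y) - 4^-1 * sqr_norm (act h y - act h x).
      have := sqr_norm_parallelogram (act h y) (act h x).
      by rewrite /z linearZ linearD sqr_normZ /= (addrC (act h x)); lra.
    have h1 := phi_ub x h Gh.
    have h2 : sqr_norm (act h y) <= phi x by apply: le_trans (phi_ub y h Gh) phiy.
    suff : `|y - x| ^+ 2 / (4 * C ^+ 2) <= 4^-1 * sqr_norm (act h y - act h x) by lra.
    rewrite invfM mulrCA ler_pM2l ?invr_gt0//.
    rewrite ler_pdivrMr ?exprn_gt0//.
    have [k Gk hk] := actV _ Gh.
    have le : `|y - x| <= C * `|act h y - act h x|.
      by rewrite -linearB -[in leLHS](hk (y - x)) actC.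
    apply: (@le_trans _ _ ((C * `|act h y - act h x|) ^+ 2)).
      by rewrite lerXn2r ?nnegrE// mulr_ge0.
    rewrite exprMn mulrC ler_wpM2r ?sqr_ge0//; exact: normr_sqr_le.
  move=> hz; have := infD z Kz => iz.
  have : `|y - x| ^+ 2 / (4 * C ^+ 2) < eps by lra.
  have C4 : 0 < 4 * C ^+ 2 by rewrite mulr_gt0// exprn_gt0.
  by rewrite ltr_pdivrMr// mulrC => /ltW.
pose B eps := [set x | K x /\ phi x < inf D + eps].
have FF : ProperFilter (filter_from [set eps : R | 0 < eps] B).
  apply: filter_from_proper => [|eps eps0]; last first.
    by have [_ [x Kx <-] ?] := inf_adherent eps0 hasD; exists x.
  apply: filter_from_filter; first by exists 1 => /=.
  move=> u v /= u0 v0; exists (Num.min u v); rewrite /= ?lt_min ?u0 ?v0//.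
  by move=> x [Kx]; rewrite -ltrBlDl lt_min !ltrBlDl => /andP[].
have [U [UU FU]] := ultraFilterLemma FF.
have UB eps : 0 < eps -> U (B eps) by move=> e0; apply: FU; exists eps.
have [x Ux] : exists x, id @ U --> x.
  apply: (@ultra_bounded_cvg _ _ _ UU _ _ id (1 + (inf D + 1))).
  apply: filterS (UB 1 ltr01) => x [Kx xD].
  have h := le_trans (normr_sqr_le _) (phi_ub x e Ge); rewrite acte in h.
  have : `|x| <= 1 + `|x| ^+ 2.
    have : 0 <= `|x| by [].
    by have := sqr_ge0 (`|x| - 1); rewrite sqrrB1; lra.
  by move: xD h => /=; lra.
exists x.
  have tx : (fun y => \tr (y *m m)) @ U --> \tr (x *m m).
    by apply: cvg_mxtrace; apply: cvg_mulmx => //; exact: cvg_cst.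
  apply/esym; apply: (cvg_unique _ _ tx) => //.
  by apply: cvg_near_cst; apply: filterS (UB 1 ltr01) => y [].
move=> g Gg; apply/eqP; rewrite -subr_eq0 -normr_le0 leNgt; apply/negP.
set d := `|act g x - x| => d0.
have near_x : \forall y \near U, (C + 1) * `|x - y| < d / 2.
  have c0 : (fun y => (C + 1) * `|x - y|) @ U --> (C + 1) * `|x - x|.
    apply: cvgM; first exact: cvg_cst.
    by apply: cvg_norm; apply: cvgB; [exact: cvg_cst|exact: Ux].
  rewrite subrr normr0 mulr0 in c0.
  by apply: (cvgr_lt _ c0); rewrite divr_gt0.
have eps0 : 0 < d ^+ 2 / (32 * C ^+ 2).
  by rewrite divr_gt0 ?mulr_gt0 ?exprn_gt0.
have [y [yx [Ky phiy]]] := filter_ex (@filterI _ U _ _ _ near_x (UB _ eps0)).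
have := almost_fixed _ y g Ky phiy Gg.
have -> : 4 * C ^+ 2 * (d ^+ 2 / (32 * C ^+ 2)) = d ^+ 2 / 8.
  by field; rewrite gt_eqF.
move=> h.
have small : `|act g y - y| <= d / 2.
  rewrite -(@ler_pXn2r _ 2) ?nnegrE ?divr_ge0// ?(ltW d0)//.
  by apply: le_trans h _; rewrite expr_div_n; have := sqr_ge0 d; lra.
have : d <= (C + 1) * `|x - y| + `|act g y - y|.
  rewrite /d; have -> : act g x - x = act g (x - y) + (act g y - y) - (x - y).
    by rewrite linearB /= addrA subrK opprB addrA subrK.
  have h1 := ler_normB (act g (x - y) + (act g y - y)) (x - y).
  have h2 := ler_normD (act g (x - y)) (act g y - y).
  have h3 := actC g (x - y) Gg.
  by rewrite mulrDl mul1r; lra.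
lra.
Qed.

End InvariantFunctional.

(** * Bounded representations of perfect groups *)

Lemma invmx_mulmx (K : comUnitRingType) n (A B : 'M[K]_n) :
  A \in unitmx -> B \in unitmx -> invmx (A *m B) = invmx B *m invmx A.
Proof.
move=> uA uB; have uAB : A *m B \in unitmx by rewrite unitmx_mul uA.
by rewrite -[RHS](mulmxK uAB) -!mulmxA (mulKmx uA) mulmxA mulVmx// mul1mx.
Qed.

Lemma normr_mulmx_le (R : realType) m n l (A : 'M[R]_(m, n))
    (B : 'M[R]_(n, l)) c d :
  0 <= d -> `|A| <= c -> `|B| <= d -> `|A *m B| <= n%:R * c * d.
Proof.
move=> d0 Ac Bd; apply: le_trans (normr_mulmx _ _) _.
by apply: ler_pM => //; rewrite ler_wpM2l.
Qed.

Lemma near_unitmx (R : realType) n (A : 'M[R]_n) :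
  A \in unitmx -> \forall B \near A, B \in unitmx.
Proof.
rewrite unitmxE unitfE => dA.
have : (fun B : 'M[R]_n => \det B) @ A --> \det A by apply: (@cvg_det _ _ (nbhs A) _); exact: cvg_id.
move=> /cvgrPdist_lt /(_ `|\det A|); rewrite normr_gt0 => /(_ dA).
apply: filterS => B; rewrite unitmxE unitfE; apply: contraTneq => ->.
by rewrite subr0 ltxx.
Qed.

(** Coordinates adapted to the subspace [K]: the rows of [B1] and [B2] are the new
    basis vectors, and [C1], [C2] read off the coordinates. *)
Lemma complement_splitting (F : fieldType) n (K : 'M[F]_n) :
  exists (B1 : 'M[F]_(\rank K, n)) (B2 : 'M[F]_(\rank (complmx K), n))
         (C1 : 'M[F]_(n, \rank K)) (C2 : 'M[F]_(n, \rank (complmx K))),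
    (B1 :=: K)%MS /\
    [/\ B1 *m C1 = 1%:M, B1 *m C2 = 0, B2 *m C2 = 1%:M &
        C1 *m B1 + C2 *m B2 = 1%:M].
Proof.
pose B := col_mx (row_base K) (row_base (complmx K)).
have rB : \rank B = n.
  apply: etrans (eqP (addsmx_compl_full K : _ == _)); rewrite -addsmxE.
  by rewrite (adds_eqmx (eq_row_base K) (eq_row_base (complmx K))).
have BC : B *m pinvmx B = 1%:M.
  by apply: mulmxVp; rewrite /row_free rB mxrank_compl subnKC// rank_leq_row.
have CB : pinvmx B *m B = 1%:M by apply: mulVpmx; rewrite /row_full rB.
have [C1 [C2 EC]] : exists C1 C2, pinvmx B = row_mx C1 C2.
  by exists (lsubmx (pinvmx B)), (rsubmx (pinvmx B)); rewrite hsubmxK.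
exists (row_base K), (row_base (complmx K)), C1, C2.
split; first exact: eq_row_base.
move: BC CB; rewrite EC mul_row_col /B mul_col_row scalar_mx_block.
by move=> /eq_block_mx[? ? _ ?] ?; split.
Qed.

Section BoundedRepresentations.
Context {R : realType} {N : nat}.
Context (G : set 'M[R]_N) (linG : linear_lie_group G).

Definition bounded_on (T : Type) (D : set T) m n (f : T -> 'M[R]_(m, n)) :=
  exists c, forall g, D g -> `|f g| <= c.

(** This says that the commutators topologically generate [G]. *)
Definition topologically_perfect := forall H, linear_lie_group H -> H `<=` G ->
  (forall A B, G A -> G B -> H (A *m B *m invmx A *m invmx B)) -> H = G.

Context (perfG : topologically_perfect).

Let G1 : G 1%:M. Proof. by case: linG. Qed.
Let GM A B : G A -> G B -> G (A *m B). Proof. by case: linG => _ _ + _ _; apply. Qed.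
Let GV A : G A -> G (invmx A). Proof. by case: linG => _ _ _ + _; apply. Qed.
Let GU A : G A -> A \in unitmx. Proof. exact: lie_group_unit. Qed.

Ltac inG := repeat first [assumption | exact: G1 | apply: GM | apply: GV].

Lemma perfect_character (chi : 'M[R]_N -> R) :
  (forall A, G A -> {for A, continuous chi}) -> chi 1%:M = 1 ->
  (forall A B, G A -> G B -> chi (A *m B) = chi A * chi B) ->
  forall A, G A -> chi A = 1.
Proof.
move=> chiC chi1 chiM A GA.
have chiV B : G B -> chi B * chi (invmx B) = 1.
  by move=> GB; rewrite -chiM ?mulmxV ?GU ?chi1//; inG.
pose H := [set B | G B /\ chi B = 1].
suff HG : H = G by move: GA; rewrite -HG => -[].
apply: perfG => [|B []//|B C GB GC]; last first.
  split; first by inG.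
  rewrite (chiM _ (invmx C)) ?(chiM _ (invmx B)) ?(chiM B C); try by inG.
  by rewrite (mulrAC (chi B)) chiV// mul1r chiV.
split => //.
- by move=> B [/GU].
- by move=> B C [GB B1] [GC C1]; split; [exact: GM|rewrite chiM// B1 C1 mulr1].
- move=> B [GB B1]; split; first exact: GV.
  by have := chiV _ GB; rewrite B1 mul1r.
- move=> B [clB uB].
  have [F [FF FH FB]] := closure_filter clB.
  have GB : G B.
    by apply: (lie_group_closed linG _ FB uB); apply: filterS FH => C [].
  split => //; have chiB : chi @ F --> chi B.
    by apply: cvg_comp FB _; exact: chiC.
  apply/esym; apply: (cvg_unique _ _ chiB) => //.
  by apply: cvg_near_cst; apply: filterS FH => C [].
Qed.

(** The map [f g = r g *m p g^-1] is a cocycle for the action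
    [g . x = q g *m x *m p g^-1]: [f (g h) = f g + g . f h].  Writing [h k] as
    [k (k^-1 h k)] and using the bound on conjugates, [f k - h . f k] is bounded
    in [k] for each fixed [h].  If [f] were unbounded, a limit [m] of its
    directions would thus be a nonzero invariant vector.  An invariant linear
    form [xi] with [xi m = 1] exists by [hyperplane_fixed_point], but [xi] composed
    with [f] is additive, hence zero by perfectness, which contradicts
    [xi m = 1]. *)
Lemma cocycle_bounded a b (p : 'M[R]_N -> 'M[R]_a) (q : 'M[R]_N -> 'M[R]_b)
    (r : 'M[R]_N -> 'M[R]_(b, a)) :
  (forall A, G A -> {for A, continuous p}) ->
  (forall A, G A -> {for A, continuous r}) ->
  p 1%:M = 1%:M -> q 1%:M = 1%:M ->
  (forall g h, G g -> G h -> p (g *m h) = p g *m p h) ->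
  (forall g h, G g -> G h -> q (g *m h) = q g *m q h) ->
  (forall g h, G g -> G h -> r (g *m h) = r g *m p h + q g *m r h) ->
  bounded_on G p -> bounded_on G q ->
  (forall h, G h -> bounded_on G (fun g => r (g *m h *m invmx g))) ->
  bounded_on G r.
Proof.
move=> pC rC p1 q1 pM qM rM [cp pb] [cq qb] rb.
have pV g : G g -> p (invmx g) *m p g = 1%:M.
  by move=> Gg; rewrite -pM ?mulVmx ?GU ?p1//; inG.
have pV' g : G g -> p g *m p (invmx g) = 1%:M.
  by move=> Gg; rewrite -pM ?mulmxV ?GU ?p1//; inG.
have qV g : G g -> q (invmx g) *m q g = 1%:M.
  by move=> Gg; rewrite -qM ?mulVmx ?GU ?q1//; inG.
have cp0 : 0 <= cp by apply: le_trans (pb _ G1).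
have cq0 : 0 <= cq by apply: le_trans (qb _ G1).
pose f g := r g *m p (invmx g).
pose act g (x : 'M[R]_(b, a)) := q g *m x *m p (invmx g).
have fM g h : G g -> G h -> f (g *m h) = f g + act g (f h).
  move=> Gg Gh; rewrite /f /act rM// invmx_mulmx ?GU// pM; try by inG.
  rewrite mulmxDl.
  rewrite !mulmxA; congr (_ + _).
  by rewrite -!mulmxA (mulmxA (p h)) pV'// mul1mx.
suff [cf fb] : bounded_on G f.
  exists (a%:R * cf * cp) => g Gg.
  have -> : r g = f g *m p g by rewrite /f -mulmxA pV// mulmx1.
  by apply: normr_mulmx_le; [|exact: fb|exact: pb].
apply: contrapT => /unbounded_direction[U [m [UU UG f0 fm m1]]].
have m_fixed h : G h -> act h m = m.
  move=> Gh; have [ch rbh] := rb h Gh.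
  have fb : exists c, forall k, G k -> `|f k - act h (f k)| <= c.
    exists (`|f h| + a%:R * (b%:R * cq * (a%:R * ch * cp)) * cp) => k Gk.
    have -> : f k - act h (f k) = f h - act k (f (invmx k *m h *m k)).
      apply/eqP; rewrite subr_eq addrAC -subr_eq opprK.
      (* both sides are [f (h k)] *)
      rewrite -!fM; try by inG.
      by rewrite !mulmxA mulmxV ?GU// mul1mx.
    apply: le_trans (ler_normB _ _) _; rewrite lerD2l.
    have ch0 : 0 <= ch by apply: le_trans (rbh _ G1).
    apply: normr_mulmx_le => //; last by apply: pb; inG.
    apply: normr_mulmx_le; [by rewrite !mulr_ge0|exact: qb|].
    apply: normr_mulmx_le => //; last by apply: pb; inG.
    by have := rbh _ (GV Gk); rewrite invmxK.
  have [c cfb] := fb.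
  have lim1 : (fun k => `|f k|^-1 *: f k - act h (`|f k|^-1 *: f k)) @ U -->
      m - act h m.
    apply: cvgB; first exact: fm.
    by apply: cvg_mulmx; [apply: cvg_mulmx; [exact: cvg_cst|exact: fm]|exact: cvg_cst].
  have lim2 : (fun k => `|f k|^-1 *: f k - act h (`|f k|^-1 *: f k)) @ U -->
      (0 : 'M[R]_(b, a)).
    apply/norm_cvg0P; apply: (@squeeze_cvgr _ _ _ _ (fun=> 0) (fun k => `|f k|^-1 * c)).
    - apply: filterS UG => k Gk; rewrite normr_ge0 /= /act -scalemxAr -scalemxAl.
      by rewrite -scalerBr normrZ normfV normr_id ler_wpM2l ?invr_ge0// cfb.
    - exact: cvg_cst.
    - have : (fun k => `|f k|^-1 * c) @ U --> 0 * c by apply: cvgM => //; exact: cvg_cst.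
      by rewrite mul0r.
  have E0 : m - act h m = 0 by exact: cvg_unique lim1 lim2.
  by apply/esym/eqP; rewrite -subr_eq0 E0.
pose dact g : {linear 'M[R]_(a, b) -> 'M[R]_(a, b)} :=
  mulmxr (q (invmx g)) \o mulmx (p g).
have [||||||xi xim xifix] := @hyperplane_fixed_point R a b _ G dact 1%:M
   (b%:R * (a%:R * cp) * cq) m G1.
- by move=> x; rewrite /dact /= invmx1 p1 q1 mul1mx mulmx1.
- move=> g h Gg Gh; exists (g *m h); first by inG.
  by move=> x; rewrite /dact /= pM// invmx_mulmx ?GU// qM; [rewrite !mulmxA|inG..].
- move=> g Gg; exists (invmx g); first by inG.
  move=> x; rewrite /dact /= invmxK !mulmxA pV// mul1mx -mulmxA qV//.
  by rewrite mulmx1.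
- move=> g x Gg; rewrite /dact /=.
  apply: le_trans (normr_mulmx_le cq0 (normr_mulmx_le _ (pb _ Gg) (lexx `|x|)) (qb _ (GV Gg))) _ => //.
  by rewrite le_eqVlt; apply/orP; left; apply/eqP; ring.
- move=> g x Gg; rewrite -{1}(m_fixed _ Gg) /dact /act /=.
  rewrite !mulmxA -(mulmxA _ (q _) (q g)) qV// mulmx1 mxtrace_mulC.
  by rewrite !mulmxA pV// mul1mx.
- by rewrite -normr_gt0 m1.
have f_tr g : G g -> \tr (xi *m f g) = 0.
  (* the exponential turns the additive character into a multiplicative one *)
  pose chi g := expR (\tr (xi *m f g)).
  move=> Gg; apply: (@expR_inj R); rewrite expR0.
  apply: (@perfect_character chi) => // {g Gg}.
  - move=> A GA; rewrite /chi.
    apply: (cvg_comp _ expR); last exact: continuous_expR.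
    apply: (@cvg_mxtrace _ _ (nbhs A) _).
    apply: (@cvg_mulmx _ _ (nbhs A) _); first exact: cvg_cst.
    apply: (@cvg_mulmx _ _ (nbhs A) _); first exact: rC.
    apply: (cvg_comp invmx p); last by apply: pC; exact: GV.
    by apply: (@cvg_invmx _ _ (nbhs A) _); [exact: GU|exact/near_unitmx/GU|exact: cvg_id].
  - have := rM _ _ G1 G1; rewrite mulmx1 p1 q1 mulmx1 mul1mx => /eqP.
    rewrite -subr_eq subrr eq_sym => /eqP r1.
    by rewrite /chi /f r1 mul0mx mulmx0 mxtrace0 expR0.
  - move=> g h Gg Gh; rewrite /chi fM// -expRD mulmxDr linearD /=; congr (expR (_ + _)).
    rewrite /act !mulmxA mxtrace_mulC !mulmxA.
    by have := xifix _ (GV Gg); rewrite /dact /= invmxK => ->.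
have lim0 : (fun g => \tr (xi *m (`|f g|^-1 *: f g))) @ U --> \tr (xi *m m).
  by apply: cvg_mxtrace; apply: cvg_mulmx; [exact: cvg_cst|exact: fm].
have lim0' : (fun g => \tr (xi *m (`|f g|^-1 *: f g))) @ U --> (0 : R).
  apply: cvg_near_cst; apply: filterS UG => g Gg.
  by rewrite -scalemxAr linearZ /= f_tr// mulr0.
have : \tr (xi *m m) = 0 by exact: cvg_unique lim0 lim0'.
by rewrite xim => /eqP; rewrite oner_eq0.
Qed.

(** Let [A] be a limit of the directions of an unbounded [rho].  Perfectness gives
    [det rho = 1], hence [det A = 0], so that the row kernel of [A] is nonzero; it
    is proper because [A != 0].  It is invariant because
    [rho h rho k = rho k rho (k^-1 h k)], where the last factor is bounded.  In
    coordinates adapted to it [rho] is block triangular; its diagonal blocks are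
    bounded by induction on [n] and the remaining one by [cocycle_bounded]. *)
Lemma bounded_representation n (rho : 'M[R]_N -> 'M[R]_n) :
  (forall A, G A -> {for A, continuous rho}) -> rho 1%:M = 1%:M ->
  (forall g h, G g -> G h -> rho (g *m h) = rho g *m rho h) ->
  (forall h, G h -> bounded_on G (fun g => rho (g *m h *m invmx g))) ->
  bounded_on G rho.
Proof.
elim/ltn_ind: n rho => n IH rho rhoC rho1 rhoM rhob.
apply: contrapT => unb; apply: (unb).
have [U [A [UU UG s0 sA A1]]] := unbounded_direction unb.
have A_neq0 : A != 0 by rewrite -normr_gt0 A1.
have n_gt0 : (0 < n)%N.
  rewrite lt0n; apply/negP => /eqP n0; have : `|A| <= 0.
    by apply: normr_mx_le => // -[i lin]; exfalso; rewrite n0 in lin.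
  by rewrite A1 ler10.
have det1 g : G g -> \det (rho g) = 1.
  move: g; apply: perfect_character.
  - move=> g Gg; apply: (@cvg_det _ _ (nbhs g) _); exact: rhoC.
  - by rewrite rho1 det1.
  - by move=> g h Gg Gh; rewrite rhoM// det_mulmx.
have detA : \det A = 0.
  have lim1 : (fun g => \det (`|rho g|^-1 *: rho g)) @ U --> \det A by exact: cvg_det.
  have lim2 : (fun g => \det (`|rho g|^-1 *: rho g)) @ U --> (0 ^+ n : R).
    have h : (fun g => `|rho g|^-1 ^+ n) @ U --> (0 ^+ n : R).
      by apply: (cvg_comp _ (fun x => x ^+ n) s0); exact: exprn_continuous.
    apply: near_eq_cvg_to h; apply: filterS UG => g Gg.
    by rewrite detZ det1// mulr1.
  by rewrite expr0n gtn_eqF// in lim2; exact: cvg_unique lim1 lim2.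
pose K := kermx A.
have Kinv h : G h -> (K *m rho h <= K)%MS.
  move=> Gh; rewrite sub_kermx; apply/eqP.
  have [c cb] := rhob h Gh.
  have lim1 : (fun k => K *m rho h *m (`|rho k|^-1 *: rho k)) @ U --> K *m rho h *m A.
    by apply: cvg_mulmx; [exact: cvg_cst|exact: sA].
  have lim2 : (fun k => K *m rho h *m (`|rho k|^-1 *: rho k)) @ U --> (0 : 'M[R]_n).
    have KA : (fun k => K *m (`|rho k|^-1 *: rho k)) @ U --> K *m A.
      by apply: cvg_mulmx; [exact: cvg_cst|exact: sA].
    rewrite (mulmx_ker A) in KA.
    apply/norm_cvg0P; apply: (@squeeze_cvgr _ _ _ _ (fun=> 0)
      (fun k => n%:R * `|K *m (`|rho k|^-1 *: rho k)| * c)).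
    - apply: filterS UG => k Gk; rewrite normr_ge0 /=.
      have -> : K *m rho h *m (`|rho k|^-1 *: rho k) =
          K *m (`|rho k|^-1 *: rho k) *m rho (invmx k *m h *m k).
        rewrite -!scalemxAr -scalemxAl -!mulmxA -!rhoM; try by inG.
        by rewrite !mulmxA mulmxV ?GU// mul1mx.
      apply: normr_mulmx_le => //.
        by apply: le_trans (cb _ G1).
      by have := cb _ (GV Gk); rewrite invmxK.
    - exact: cvg_cst.
    - have : (fun k => n%:R * `|K *m (`|rho k|^-1 *: rho k)| * c) @ U -->
          n%:R * `|0 : 'M[R]_n| * c.
        apply: cvgM; last exact: cvg_cst.
        by apply: cvgM; [exact: cvg_cst|exact: cvg_norm].
      by rewrite normr0 mulr0 mul0r.
  exact: cvg_unique lim1 lim2.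
have rA0 : (0 < \rank A)%N by rewrite lt0n mxrank_eq0.
have rAn : (\rank A < n)%N.
  rewrite ltn_neqAle rank_leq_row andbT; apply/negP => fA.
  have : row_free A by exact: fA.
  by rewrite row_free_unit unitmxE unitfE detA eqxx.
have [B1 [B2 [C1 [C2 [BK [B1C1 B1C2 B2C2 CB]]]]]] := complement_splitting K.
have rK : \rank K = (n - \rank A)%N by rewrite mxrank_ker.
have invB h : G h -> B1 *m rho h *m C2 = 0.
  move=> Gh; have : (B1 *m rho h <= B1)%MS.
    by rewrite (eqmxMr _ BK) BK Kinv.
  by case/submxP=> D ->; rewrite -mulmxA B1C2 mulmx0.
pose p g := B1 *m rho g *m C1.
pose q g := B2 *m rho g *m C2.
pose r g := B2 *m rho g *m C1.
have contC a b (C : 'M[R]_(a, n)) (D : 'M[R]_(n, b)) g : G g ->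
    {for g, continuous (fun g => C *m rho g *m D)}.
  move=> Gg; apply: (@cvg_mulmx _ _ (nbhs g) _); last exact: cvg_cst.
  by apply: (@cvg_mulmx _ _ (nbhs g) _); [exact: cvg_cst|exact: rhoC].
have conjC a b (C : 'M[R]_(a, n)) (D : 'M[R]_(n, b)) h : G h ->
    bounded_on G (fun g => C *m rho (g *m h *m invmx g) *m D).
  move=> /rhob[c cb]; exists (n%:R * (n%:R * `|C| * c) * `|D|) => g Gg.
  have c0 : 0 <= c by apply: le_trans (cb _ G1).
  by apply: normr_mulmx_le => //; apply: normr_mulmx_le => //; exact: cb.
have rhoE a (C : 'M[R]_(a, n)) h :
    C *m rho h = C *m C1 *m (B1 *m rho h) + C *m C2 *m (B2 *m rho h).
  by rewrite !mulmxA -mulmxDl -!(mulmxA C) -mulmxDr CB mulmx1.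
have pM g h : G g -> G h -> p (g *m h) = p g *m p h.
  move=> Gg Gh; rewrite /p rhoM// (mulmxA B1) (rhoE _ (B1 *m rho g)) invB// mul0mx addr0.
  by rewrite !mulmxA.
have qM g h : G g -> G h -> q (g *m h) = q g *m q h.
  move=> Gg Gh; rewrite /q rhoM// (mulmxA B2) (rhoE _ (B2 *m rho g)) mulmxDl.
  by rewrite -(mulmxA _ (B1 *m _)) invB// mulmx0 add0r !mulmxA.
have rM g h : G g -> G h -> r (g *m h) = r g *m p h + q g *m r h.
  move=> Gg Gh; rewrite /r /p /q rhoM// (mulmxA B2) (rhoE _ (B2 *m rho g)) mulmxDl.
  by rewrite !mulmxA.
have p1 : p 1%:M = 1%:M by rewrite /p rho1 mulmx1.
have q1 : q 1%:M = 1%:M by rewrite /q rho1 mulmx1.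
have pb : bounded_on G p.
  apply: (IH _ _ p _ p1 pM).
  - by rewrite rK ltn_subrL rA0.
  - by move=> g; exact: contC.
  - by move=> h; exact: conjC.
have qb : bounded_on G q.
  apply: (IH _ _ q _ q1 qM).
  - by rewrite mxrank_compl rK ltn_subrL subn_gt0 rAn.
  - by move=> g; exact: contC.
  - by move=> h; exact: conjC.
have [cr rb] : bounded_on G r.
  apply: (@cocycle_bounded _ _ p q r _ _ p1 q1 pM qM rM pb qb).
  - by move=> g; exact: contC.
  - by move=> g; exact: contC.
  - by move=> h; exact: conjC.
have sandwich a b (C : 'M[R]_(n, a)) (D : 'M[R]_(b, n)) (f : 'M[R]_N -> 'M[R]_(a, b)) :
    bounded_on G f -> bounded_on G (fun g => C *m f g *m D).
  move=> [c fc]; exists (b%:R * (a%:R * `|C| * c) * `|D|) => g Gg.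
  have c0 : 0 <= c by apply: le_trans (fc _ G1).
  by apply: normr_mulmx_le => //; apply: normr_mulmx_le => //; exact: fc.
have [cp' pb'] := sandwich _ _ C1 B1 p pb.
have [cq' qb'] := sandwich _ _ C2 B2 q qb.
have [cr' rb'] := sandwich _ _ C2 B1 r (ex_intro _ cr rb).
exists (cp' + cr' + cq') => g Gg.
have -> : rho g = C1 *m p g *m B1 + C2 *m r g *m B1 + C2 *m q g *m B2.
  rewrite -[LHS]mul1mx -[LHS]mulmx1 -CB !mulmxDl !mulmxDr.
  have -> : C1 *m B1 *m rho g *m (C2 *m B2) = 0.
    by rewrite -!mulmxA (mulmxA (rho g)) (mulmxA B1) (mulmxA B1) invB// mul0mx mulmx0.
  by rewrite addr0 /p /q /r !mulmxA addrA.
apply: le_trans (ler_normD _ _) _; apply: lerD; last exact: qb'.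
by apply: le_trans (ler_normD _ _) _; apply: lerD; [exact: pb'|exact: rb'].
Qed.

End BoundedRepresentations.

(** * Simple groups with a bounded adjoint orbit *)

Section SimpleGroups.
Context {R : realType} {n : nat}.
Context (G : set 'M[R]_n) (linG : linear_lie_group G) (connG : connected G).
Context (simpleG : simple_lie_algebra (lie_algebra G)).

Let G1 : G 1%:M. Proof. by case: linG. Qed.
Let GM A B : G A -> G B -> G (A *m B). Proof. by case: linG => _ _ + _ _; apply. Qed.
Let GV A : G A -> G (invmx A). Proof. by case: linG => _ _ _ + _; apply. Qed.
Let GU A : G A -> A \in unitmx. Proof. exact: lie_group_unit. Qed.

(** A closed subgroup [H] containing all commutators is normal, so its Lie
    algebra is an ideal, which is nonzero because it contains all brackets. *)
Lemma simple_group_perfect : topologically_perfect G.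
Proof.
move=> H linH HG HC.
have Hnorm A B : G A -> H B -> H (A *m B *m invmx A).
  move=> GA HB; have GB := HG _ HB.
  have [_ _ HM _ _] := linH.
  by have := HM _ _ (HC A B GA GB) HB; rewrite mulmxKV// GU.
have Hg : lie_algebra H `<=` lie_algebra G by move=> X HX t; exact: HG.
have ideal : lie_ideal (lie_algebra G) (lie_algebra H).
  apply: Ad_invariant_ideal => //.
  - exact: lie_algebra0.
  - by move=> a X Y; exact: lie_algebra_lin.
  - by move=> A X GA; apply: (lie_algebra_Ad linG GA) => B; exact: Hnorm.
have [[X [Y [GX GY XY]]] simple] := simpleG.
apply: (lie_subgroup_full linG connG linH HG).
have [H0|->//] := simple _ ideal.
have : lie_algebra H (bracket X Y) by exact: (lie_algebra_commutator linH HC).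
by rewrite H0 => /XY.
Qed.

(** For [M] in the Lie algebra this says that the adjoint orbit is bounded; for
    [M] in [G] it is boundedness of a conjugacy class. *)
Definition conj_bounded (M : 'M[R]_n) := bounded_on G (fun g => g *m M *m invmx g).

Lemma conj_bounded_lin a X Y :
  conj_bounded X -> conj_bounded Y -> conj_bounded (a *: X + Y).
Proof.
move=> [c Xc] [d Yd]; exists (`|a| * c + d) => g Gg.
rewrite mulmxDr mulmxDl -scalemxAr -scalemxAl.
apply: le_trans (ler_normD _ _) _; apply: lerD; last exact: Yd.
by rewrite normrZ ler_wpM2l// Xc.
Qed.

Lemma conj_bounded0 : conj_bounded 0.
Proof. by exists 0 => g _; rewrite mulmx0 mul0mx normr0. Qed.

Lemma conj_boundedM X Y :
  conj_bounded X -> conj_bounded Y -> conj_bounded (X *m Y).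
Proof.
move=> [c Xc] [d Yd]; exists (n%:R * c * d) => g Gg.
have -> : g *m (X *m Y) *m invmx g = g *m X *m invmx g *m (g *m Y *m invmx g).
  by rewrite !mulmxA mulmxKV// GU.
apply: normr_mulmx_le; [|exact: Xc|exact: Yd].
by apply: le_trans (Yd _ G1).
Qed.

Lemma conj_bounded_closed : closed conj_bounded.
Proof.
by apply: subspace_closed; [exact: conj_bounded0|exact: conj_bounded_lin].
Qed.

Lemma conj_bounded_Ad A X : G A -> conj_bounded X -> conj_bounded (Ad A X).
Proof.
move=> GA [c Xc]; exists c => g Gg; have := Xc _ (GM Gg GA).
by rewrite invmx_mulmx ?GU// /Ad !mulmxA.
Qed.

Lemma conj_bounded_expmx X : conj_bounded X -> conj_bounded (expmx X).
Proof.
move=> [c Xc]; exists (expR (n%:R * c)) => g Gg.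
rewrite expmx_conj ?GU//; apply: le_trans (normr_expmx_le _) _.
by rewrite ler_expR ler_wpM2l// Xc.
Qed.

(** The vectors with bounded orbits form a nonzero ideal. *)
Lemma bounded_orbit_lie_algebra x : lie_algebra G x -> x != 0 ->
  conj_bounded x -> lie_algebra G `<=` conj_bounded.
Proof.
move=> Gx x0 bx; pose I := lie_algebra G `&` conj_bounded.
have ideal : lie_ideal (lie_algebra G) I.
  apply: Ad_invariant_ideal => //.
  - by move=> X [].
  - by split; [exact: lie_algebra0|exact: conj_bounded0].
  - by move=> a X Y [? ?] [? ?]; split; [exact: lie_algebra_lin|exact: conj_bounded_lin].
  - move=> A X GA [GX bX]; split; last exact: conj_bounded_Ad.
    by apply: (lie_algebra_Ad linG GA) GX => B GB; apply: GM; [exact: GM|exact: GV].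
have [_ simple] := simpleG.
have [I0|IG] := simple _ ideal.
  have : I x by [].
  by rewrite I0 => x00; rewrite x00 eqxx in x0.
by rewrite -IG => X [].
Qed.

(** Conjugation commutes with [expmx], so exponentials have bounded conjugacy
    classes, and the elements with this property form a closed subgroup. *)
Lemma bounded_lie_algebra_group :
  lie_algebra G `<=` conj_bounded -> G `<=` conj_bounded.
Proof.
move=> gb; pose H := [set A | [/\ G A, conj_bounded A & conj_bounded (invmx A)]].
have b1 : conj_bounded 1%:M.
  by exists 1 => g Gg; rewrite mulmx1 mulmxV ?GU// normr_mx1_le.
have linH : linear_lie_group H.
  split.
  - by move=> A [/GU].
  - by split => //; rewrite invmx1.
  - move=> A B [GA bA bA'] [GB bB bB']; split; [exact: GM|exact: conj_boundedM|].
    by rewrite invmx_mulmx ?GU//; exact: conj_boundedM.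
  - by move=> A [GA bA bA']; split; [exact: GV|by []|rewrite invmxK].
  - move=> A [clA uA]; have [F [FF FH FA]] := closure_filter clA.
    split.
    + by apply: (lie_group_closed linG _ FA uA); apply: filterS FH => B [].
    + apply: conj_bounded_closed; apply: (cvg_closure FA).
      by apply: filterS FH => B [].
    + apply: conj_bounded_closed.
      have iA : invmx @ F --> invmx A.
        apply: cvg_invmx => //.
        by apply: filterS FH => B [/GU].
      by apply: (cvg_closure iA); apply: filterS FH => B [].
have HE : H = G.
  apply: (lie_subgroup_full linG connG linH); first by move=> A [].
  move=> X GX t; split; first exact: GX.
    by apply: conj_bounded_expmx; apply: gb; exact: lie_algebraZ GX.
  rewrite invmx_expmx -scaleNr.
  by apply: conj_bounded_expmx; apply: gb; exact: lie_algebraZ GX.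
by rewrite -{1}HE => A [].
Qed.

(** The inclusion of [G] is a representation with bounded conjugacy classes, so
    [G] is bounded.  Its closure consists of matrices of determinant [1], so [G]
    is closed in the space of all matrices. *)
Lemma conj_bounded_compact : G `<=` conj_bounded -> compact G.
Proof.
move=> Gb.
have [c Gc] : bounded_on G (id : 'M[R]_n -> 'M[R]_n).
  apply: (bounded_representation linG simple_group_perfect (rho := id)) => //.
  by move=> A _; exact: cvg_id.
have det1 A : G A -> \det A = 1.
  move: A; apply: (perfect_character linG simple_group_perfect).
  - by move=> A _; apply: (@cvg_det _ _ (nbhs A) _); exact: cvg_id.
  - by rewrite det1.
  - by move=> A B _ _; rewrite det_mulmx.
apply: (@bounded_closed_compact_mx _ _ _ _ c) => // A clA.
have [F [FF FG FA]] := closure_filter clA.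
apply: (lie_group_closed linG FG FA).
have lim1 : (fun B : 'M[R]_n => \det B) @ F --> \det A by exact: cvg_det.
have lim2 : (fun B : 'M[R]_n => \det B) @ F --> (1 : R).
  by apply: cvg_near_cst; apply: filterS FG => B /det1.
have -> : A \in unitmx = (\det A != 0) by rewrite unitmxE unitfE.
have -> : \det A = 1 by exact: cvg_unique lim1 lim2.
exact: oner_neq0.
Qed.

(** Take [nu] to be the inverse of the norm of [Ad g x]. *)
Lemma unbounded_orbit_limit x : lie_algebra G x -> ~ conj_bounded x ->
  exists2 y, orbit_limit G x y & y != 0.
Proof.
move=> Gx /unbounded_direction[U [y [UU UG s0 sy y1]]].
exists y; last by rewrite -normr_gt0 y1.
have GAd g : G g -> lie_algebra G (Ad g x).
  move=> Gg; apply: (lie_algebra_Ad linG Gg) Gx => B GB.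
  by apply: GM; [exact: GM|exact: GV].
have s_gt0 : \forall g \near U, 0 < `|g *m x *m invmx g|^-1.
  have yn0 : y != 0 by rewrite -normr_gt0 y1.
  apply: filterS (cvgr_neq0 _ sy yn0) => g.
  by rewrite scaler_eq0 negb_or => /andP[]; rewrite lt0r invr_ge0 normr_ge0 andbT.
move=> e /= e0; split.
  have cg := lie_algebra_closed linG; apply: cg; apply: (cvg_closure sy).
  by apply: filterS UG => g Gg; exact: (lie_algebraZ _ (GAd g Gg)).
apply: (cvg_closure sy).
have se : \forall g \near U, `|g *m x *m invmx g|^-1 < e by exact: (cvgr_lt _ s0).
apply: filterS3 UG s_gt0 se => g Gg sg ge.
exists (`|g *m x *m invmx g|^-1) => /=; first by rewrite sg.
by exists g => //; rewrite /Ad -scalemxAr -scalemxAl.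
Qed.

End SimpleGroups.

Unset Implicit Arguments.
Set Strict Implicit.

Theorem theorem5p1 (R : realType) (n : nat) (G : set 'M[R]_n)
    (linG : linear_lie_group G)
    (connG : connected G)
    (simpleG : simple_lie_algebra (lie_algebra G))
    (ncG : ~ compact G) :
  forall x : 'M[R]_n, lie_algebra G x -> x != 0 ->
    orbit_limit G x <> [set 0].
Proof.
move=> x Gx x0 lim0; have [bx|nbx] := pselect (conj_bounded G x).
  apply: ncG; apply: (conj_bounded_compact linG connG simpleG).
  apply: (bounded_lie_algebra_group linG connG).
  exact: (bounded_orbit_lie_algebra linG simpleG Gx x0 bx).
have [y] := unbounded_orbit_limit linG Gx nbx.
by rewrite lim0 => -> /eqP.
Qed.
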